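(* Let $\mathcal{C}$ be any one of the following classes of relational inquisitive modal models: the class of all relational models; the class of all finite relational models; the class of all locally full relational models; the class of all finite locally full relational models. Then: (a) a property of world-pointed models $(\mathfrak{M},w)$ with $\mathfrak{M}\in\mathcal{C}$ is definable in InqML over $\mathcal{C}$ if and only if it is both first-order definable over $\mathcal{C}$ and invariant under bisimilarity $\sim$ over $\mathcal{C}$; (b) a property of state-pointed models $(\mathfrak{M},s)$ with $\mathfrak{M}\in\mathcal{C}$ is definable in InqML over $\mathcal{C}$ if and only if it is first-order definable over $\mathcal{C}$, downward closed, and invariant under $\sim$ over $\mathcal{C}$.
   Context: Let $\mathcal{P}=\{p_i:i\in I\}$ be a set of atoms. A relational inquisitive modal model is a two-sorted structure $\mathfrak{M}=(W,S,E,\varepsilon,(P_i)_{i\in I})$ with non-empty sets $W$ (worlds) and $S$ (states), relations $E,\varepsilon\subseteq W\times S$ and $P_i\subseteq W$, such that, writing $\underline{s}=\{w:w\,\varepsilon\, s\}$: (extensionality) $\underline{s}=\underline{s'}$ implies $s=s'$; (local powerset) if $s\in S$ and $t\subseteq\underline s$ then $t=\underline{s'}$ for some $s'\in S$; (non-emptiness) $E[w]\neq\emptyset$ for every $w$; (downward closure) if $s\in E[w]$ and $\underline{s'}\subseteq\underline s$ then $s'\in E[w]$. Thus $S$ may be identified with a set of subsets of $W$ and $\varepsilon$ with membership. $\mathfrak{M}$ is finite if $W$ and $S$ are finite, and locally full if $\wp(\bigcup E[w])\subseteq S$ for all $w\in W$. World-pointed models are pairs $(\mathfrak{M},w)$ with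 $w\in W$; state-pointed models are pairs $(\mathfrak{M},s)$ with $s\in S$. $\mathfrak{M}$ determines the inquisitive modal model $\mathfrak{M}^*=(W,\Sigma,V)$ with $\Sigma(w)=E[w]$, $V(p_i)=P_i$. (An inquisitive modal model is $(W,\Sigma,V)$ with $\Sigma(w)$ a non-empty downward closed set of subsets of $W$; $\sigma(w):=\bigcup\Sigma(w)$.) InqML formulae: $\varphi::=p\mid\bot\mid\varphi\wedge\varphi\mid\varphi\to\varphi\mid\varphi\bar\vee\varphi\mid\Box\varphi\mid\boxplus\varphi$ with support semantics on information states $s\subseteq W$: $s\models p$ iff $s\subseteq V(p)$; $s\models\bot$ iff $s=\emptyset$; $\wedge$ componentwise; $s\models\varphi\to\psi$ iff every $t\subseteq s$ supporting $\varphi$ supports $\psi$; $s\models\varphi\bar\vee\psi$ iff $s\models\varphi$ or $s\models\psi$; $s\models\Box\varphi$ iff $\sigma(w)\models\varphi$ for all $w\in s$; $s\models\boxplus\varphi$ iff every $t\in\Sigma(w)$, $w\in s$, supports $\varphi$. Truth at $w$ means support at $\{w\}$. A property of world-pointed (state-pointed) models is InqML-definable over $\mathcal{C}$ if there is a formula $\varphi$ such that for all $(\mathfrak{M},w)$ (resp. $(\mathfrak{M},s)$) with $\mathfrak{M}\in\mathcal{C}$, the property holds iff $\varphi$ is true at $w$ (resp. supported at $s$) in $\mathfrak{M}^*$. First-order logic here is two-sorted, with binary symbols $E,\varepsilon$ (world-sort $\times$ state-sort), unary $P_i$ on the world sort, and equality. A property is first-order definable over $\mathcal{C}$ if some first-order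 formula $\varphi(x)$ with a single free variable of the appropriate sort defines it on all pointed models from $\mathcal{C}$. Bisimilarity: the bisimulation game between inquisitive models $\mathcal{M},\mathcal{M}'$ alternates world-positions $(w,w')$ and state-positions $(s,s')$: from a world-position, player I picks a state in $\Sigma(w)$ or in $\Sigma'(w')$ and II answers with a state in the other one; from a state-position, I picks a world in $s$ or $s'$ and II answers with a world in the other. A stuck player loses; II loses at any world-position disagreeing on some atom; otherwise (e.g. infinite plays) II wins. $(\mathfrak{M},w)\sim(\mathfrak{M}',w')$ iff II has a winning strategy in this unbounded game on $\mathfrak{M}^*,\mathfrak{M}'^*$ from $(w,w')$; $(\mathfrak{M},s)\sim(\mathfrak{M}',s')$ iff each world of $s$ is bisimilar to some world of $s'$ and vice versa. A property is invariant under $\sim$ over $\mathcal{C}$ if it agrees on any two bisimilar pointed models from $\mathcal{C}$. A property of state-pointed models is downward closed if whenever it holds of $(\mathfrak{M},s)$ and $t\subseteq s$, $t\in S$, it holds of $(\mathfrak{M},t)$.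
   Formalization: Part (b) additionally requires that the property hold of at least one state-pointed model from the class: the property holding of none is first-order definable, downward closed and invariant, but not InqML-definable, as every formula is supported at the empty state. *)

(* Defs.v *)
From mathcomp Require Import all_boot.
From mathcomp Require Import boolp classical_sets cardinality.

Set Implicit Arguments.
Unset Strict Implicit.
Unset Printing Implicit Defensive.

Local Open Scope classical_set_scope.

(** * Relational inquisitive modal models *)

Definition extent (W S : Type) (eps : W -> S -> Prop) (s : S) : set W :=
  [set w | eps w s].

Record rel_model (I : Type) := RelModel {
  world : Type;
  state : Type;
  rel_E : world -> state -> Prop;
  rel_eps : world -> state -> Prop;
  rel_P : I -> set world;
  world_inhabited : inhabited world;
  state_inhabited : inhabited state;
  rel_extensional : forall s s' : state,
    extent rel_eps s = extent rel_eps s' -> s = s';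
  rel_powerset : forall (s : state) (t : set world),
    t `<=` extent rel_eps s -> exists s' : state, extent rel_eps s' = t;
  rel_E_nonempty : forall w : world, exists s : state, rel_E w s;
  rel_E_down : forall (w : world) (s s' : state),
    rel_E w s -> extent rel_eps s' `<=` extent rel_eps s -> rel_E w s'
}.

Arguments rel_E {I} M w s : rename.
Arguments rel_eps {I} M w s : rename.
Arguments rel_P {I} M i : rename.

Definition members (I : Type) (M : rel_model I) (s : state M) : set (world M) :=
  extent (rel_eps M) s.

Definition finite_model (I : Type) (M : rel_model I) : Prop :=
  finite_set [set: world M] /\ finite_set [set: state M].

Definition locally_full (I : Type) (M : rel_model I) : Prop :=
  forall (w : world M) (t : set (world M)),
    t `<=` \bigcup_(s in [set s | rel_E M w s]) members s ->
    exists s' : state M, members s' = t.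

Inductive model_class :=
  | AllModels | FiniteModels | LocallyFullModels | FiniteLocallyFullModels.

Definition in_class (C : model_class) (I : Type) (M : rel_model I) : Prop :=
  match C with
  | AllModels => True
  | FiniteModels => finite_model M
  | LocallyFullModels => locally_full M
  | FiniteLocallyFullModels => finite_model M /\ locally_full M
  end.

(** * Inquisitive modal models *)

Record inq_model (I : Type) := InqModel {
  iworld : Type;
  Sigma : iworld -> set (set iworld);
  ival : I -> set iworld;
  Sigma_nonempty : forall w : iworld, Sigma w !=set0;
  Sigma_down : forall (w : iworld) (s t : set iworld),
    Sigma w s -> t `<=` s -> Sigma w t
}.

Arguments Sigma {I} N w _ : rename.
Arguments ival {I} N i _ : rename.

Definition sigma (I : Type) (N : inq_model I) (w : iworld N) : set (iworld N) :=
  \bigcup_(s in Sigma N w) s.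

Section Star.
Variables (I : Type) (M : rel_model I).

Definition star_Sigma (w : world M) : set (set (world M)) :=
  [set members s | s in [set s | rel_E M w s]].

Lemma star_Sigma_nonempty (w : world M) : star_Sigma w !=set0.
Proof.
by have [s Es] := rel_E_nonempty w; exists (members s); exists s.
Qed.

Lemma star_Sigma_down (w : world M) (s t : set (world M)) :
  star_Sigma w s -> t `<=` s -> star_Sigma w t.
Proof.
move=> [s0 Es0 <-] ts0; have [t0 t0E] := rel_powerset ts0.
exists t0; last exact: t0E.
by apply: (rel_E_down Es0); rewrite t0E.
Qed.

Definition star : inq_model I :=
  InqModel (rel_P M) star_Sigma_nonempty star_Sigma_down.

End Star.

(** * InqML *)

Inductive inqml (I : Type) :=
  | Atom of I
  | Bot
  | And of inqml I & inqml I
  | Imp of inqml I & inqml I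
  | InqOr of inqml I & inqml I
  | Box of inqml I
  | Boxplus of inqml I.

Arguments Bot {I}.

Fixpoint support (I : Type) (N : inq_model I) (s : set (iworld N))
    (phi : inqml I) {struct phi} : Prop :=
  match phi with
  | Atom i => s `<=` ival N i
  | Bot => s = set0
  | And a b => support s a /\ support s b
  | Imp a b => forall t : set (iworld N), t `<=` s -> support t a -> support t b
  | InqOr a b => support s a \/ support s b
  | Box a => forall w : iworld N, s w -> support (sigma w) a
  | Boxplus a => forall w : iworld N, s w ->
      forall t : set (iworld N), Sigma N w t -> support t a
  end.

Definition true_at (I : Type) (N : inq_model I) (w : iworld N)
  (phi : inqml I) : Prop := support [set w] phi.

(** * Two-sorted first-order logic *)

(* World variables and state variables are two disjoint copies of [nat]. *)
Inductive fo (I : Type) :=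
  | FE (x y : nat)     (* world variable x, state variable y *)
  | Feps (x y : nat)   (* world variable x, state variable y *)
  | FP (i : I) (x : nat)
  | FEqW (x x' : nat)
  | FEqS (y y' : nat)
  | FBot
  | FAnd of fo I & fo I
  | FOr of fo I & fo I
  | FImp of fo I & fo I
  | FAllW of nat & fo I
  | FExW of nat & fo I
  | FAllS of nat & fo I
  | FExS of nat & fo I.

Arguments FE {I} x y.
Arguments Feps {I} x y.
Arguments FEqW {I} x x'.
Arguments FEqS {I} y y'.
Arguments FBot {I}.

Fixpoint fvW (I : Type) (phi : fo I) : seq nat :=
  match phi with
  | FE x _ | Feps x _ | FP _ x => [:: x]
  | FEqW x x' => [:: x; x']
  | FEqS _ _ | FBot => [::]
  | FAnd a b | FOr a b | FImp a b => fvW a ++ fvW b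
  | FAllW x a | FExW x a => [seq z <- fvW a | z != x]
  | FAllS _ a | FExS _ a => fvW a
  end.

Fixpoint fvS (I : Type) (phi : fo I) : seq nat :=
  match phi with
  | FE _ y | Feps _ y => [:: y]
  | FEqS y y' => [:: y; y']
  | FP _ _ | FEqW _ _ | FBot => [::]
  | FAnd a b | FOr a b | FImp a b => fvS a ++ fvS b
  | FAllW _ a | FExW _ a => fvS a
  | FAllS y a | FExS y a => [seq z <- fvS a | z != y]
  end.

Fixpoint fo_sat (I : Type) (M : rel_model I)
    (a : nat -> world M) (b : nat -> state M) (phi : fo I) {struct phi} : Prop :=
  match phi with
  | FE x y => rel_E M (a x) (b y)
  | Feps x y => rel_eps M (a x) (b y)
  | FP i x => rel_P M i (a x)
  | FEqW x x' => a x = a x'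
  | FEqS y y' => b y = b y'
  | FBot => False
  | FAnd f g => fo_sat a b f /\ fo_sat a b g
  | FOr f g => fo_sat a b f \/ fo_sat a b g
  | FImp f g => fo_sat a b f -> fo_sat a b g
  | FAllW x f => forall w : world M, fo_sat [eta a with x |-> w] b f
  | FExW x f => exists w : world M, fo_sat [eta a with x |-> w] b f
  | FAllS y f => forall s : state M, fo_sat a [eta b with y |-> s] f
  | FExS y f => exists s : state M, fo_sat a [eta b with y |-> s] f
  end.

(** * The bisimulation game *)

Section Game.
Variables (I : Type) (N N' : inq_model I).

Inductive position :=
  | WorldPos of iworld N & iworld N'
  | StatePos of set (iworld N) & set (iworld N').

(* The intermediate situation after player I's choice: in [StateL] and
   [WorldL], I picked on the [N] side and II answers on the [N'] side; in [StateR]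
   and [WorldR] the other way round. *)
Inductive challenge :=
  | StateL of set (iworld N) & iworld N'
  | StateR of iworld N & set (iworld N')
  | WorldL of iworld N & set (iworld N')
  | WorldR of set (iworld N) & iworld N'.

Inductive moveI : position -> challenge -> Prop :=
  | MoveI_StateL w w' s of Sigma N w s : moveI (WorldPos w w') (StateL s w')
  | MoveI_StateR w w' s' of Sigma N' w' s' : moveI (WorldPos w w') (StateR w s')
  | MoveI_WorldL (s : set (iworld N)) (s' : set (iworld N')) w of s w :
      moveI (StatePos s s') (WorldL w s')
  | MoveI_WorldR (s : set (iworld N)) (s' : set (iworld N')) w' of s' w' :
      moveI (StatePos s s') (WorldR s w').

Inductive moveII : challenge -> position -> Prop :=
  | MoveII_StateL s w' s' of Sigma N' w' s' : moveII (StateL s w') (StatePos s s')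
  | MoveII_StateR w s' s of Sigma N w s : moveII (StateR w s') (StatePos s s')
  | MoveII_WorldL w (s' : set (iworld N')) w' of s' w' :
      moveII (WorldL w s') (WorldPos w w')
  | MoveII_WorldR (s : set (iworld N)) w' w of s w :
      moveII (WorldR s w') (WorldPos w w').

Definition atoms_agree (p : position) : Prop :=
  match p with
  | WorldPos w w' => forall i : I, ival N i w <-> ival N' i w'
  | StatePos _ _ => True
  end.

(* For a fixed initial position, the history of a play in which II follows her
   strategy is determined by I's choices; these are listed latest first, the
   head being the choice that II has to answer. *)
Definition strategy := seq challenge -> position.

Inductive play (f : strategy) (p0 : position) : seq challenge -> position -> Prop :=
  | PlayStart : play f p0 [::] p0
  | PlayRound h p c of play f p0 h p & moveI p c :
      play f p0 (c :: h) (f (c :: h)).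

Definition winning (f : strategy) (p0 : position) : Prop :=
  forall (h : seq challenge) (p : position), play f p0 h p ->
    atoms_agree p /\
    forall c : challenge, moveI p c -> moveII c (f (c :: h)).

Definition II_wins (p0 : position) : Prop :=
  exists f : strategy, winning f p0.

End Game.

Definition world_bisim (I : Type) (M M' : rel_model I)
    (w : world M) (w' : world M') : Prop :=
  II_wins (@WorldPos I (star M) (star M') w w').

Definition state_bisim (I : Type) (M M' : rel_model I)
    (s : state M) (s' : state M') : Prop :=
  (forall w, members s w -> exists2 w', members s' w' & world_bisim w w') /\
  (forall w', members s' w' -> exists2 w, members s w & world_bisim w w').

(** * Properties of pointed models *)

Definition world_property (I : Type) := forall M : rel_model I, world M -> Prop.
Definition state_property (I : Type) := forall M : rel_model I, state M -> Prop.

Section Properties.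
Variables (C : model_class) (I : Type).

Definition world_inqml_definable (P : world_property I) : Prop :=
  exists phi : inqml I, forall (M : rel_model I) (w : world M),
    in_class C M -> (P M w <-> true_at (N := star M) w phi).

Definition world_fo_definable (P : world_property I) : Prop :=
  exists (phi : fo I) (x : nat),
    [/\ {subset fvW phi <= [:: x]}, fvS phi = [::] &
        forall (M : rel_model I) (w : world M), in_class C M ->
        forall (a : nat -> world M) (b : nat -> state M),
          P M w <-> fo_sat [eta a with x |-> w] b phi].

Definition world_bisim_invariant (P : world_property I) : Prop :=
  forall (M M' : rel_model I) (w : world M) (w' : world M'),
    in_class C M -> in_class C M' -> world_bisim w w' -> (P M w <-> P M' w').

Definition state_inqml_definable (P : state_property I) : Prop :=
  exists phi : inqml I, forall (M : rel_model I) (s : state M),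
    in_class C M -> (P M s <-> support (N := star M) (members s) phi).

Definition state_fo_definable (P : state_property I) : Prop :=
  exists (phi : fo I) (y : nat),
    [/\ {subset fvS phi <= [:: y]}, fvW phi = [::] &
        forall (M : rel_model I) (s : state M), in_class C M ->
        forall (a : nat -> world M) (b : nat -> state M),
          P M s <-> fo_sat a [eta b with y |-> s] phi].

Definition state_bisim_invariant (P : state_property I) : Prop :=
  forall (M M' : rel_model I) (s : state M) (s' : state M'),
    in_class C M -> in_class C M' -> state_bisim s s' -> (P M s <-> P M' s').

Definition downward_closed (P : state_property I) : Prop :=
  forall (M : rel_model I) (s t : state M),
    in_class C M -> P M s -> members t `<=` members s -> P M t.

(* Every InqML formula is supported at the empty state, which belongs to every
   relational model.  Hence the property that holds of no state-pointed model is
   not definable, although it is first-order definable ([FBot]) and vacuously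
   downward closed and invariant.  For a downward closed invariant property,
   holding somewhere and holding at all empty states are the same. *)
Definition state_nonempty (P : state_property I) : Prop :=
  exists (M : rel_model I) (s : state M), in_class C M /\ P M s.

End Properties.

(* Main.v *)
(* Let [P] be defined by a first-order formula of quantifier rank q and put
   l = 2 ^ q.  Two worlds x, x' of one model (for instance of a disjoint union)
   that are l-step bisimilar for the atoms of the formula have fully bisimilar
   copies in a layered companion model: its worlds are the triples (k, x, x')
   with k <= l, a world of layer k < l sees only layer k + 1, and the allowed
   states there are those whose two projections are allowed at x and at x'; in
   the last layer only the first component matters.  Projection to the first
   component is then a bisimulation, so (0, x, x') and (0, x', x) are bisimilar
   to x and x'.  Exchanging the two components up to some layer m respects
   everything except the relation E between layers m and m + 1.  A formula of
   rank q cannot notice this, since m can be kept away from all quantified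
   points: each of them leaves one half of the available range of layers
   untouched.  The states of the companion are all the sets contained in one
   layer, so it is locally full, and finite if the given models are.  Hence [P]
   is invariant under l-step bisimilarity, which has finitely many classes,
   each defined by an InqML formula. *)
From mathcomp Require Import all_boot.
From mathcomp Require Import boolp classical_sets cardinality.
From mathcomp Require Import zify.
Require Import Defs.

Set Implicit Arguments.
Unset Strict Implicit.
Unset Printing Implicit Defensive.

Local Open Scope classical_set_scope.

(** * From InqML to first-order logic *)

Section Translation.
Variable I : Type.

Definition fo_all (J : finType) (F : J -> fo I) : fo I :=
  foldr (fun j => FAnd (F j)) (FImp FBot FBot) (enum J).

Definition fo_any (J : finType) (F : J -> fo I) : fo I :=
  foldr (fun j => FOr (F j)) FBot (enum J).

Lemma fo_sat_all (M : rel_model I) (J : finType) (F : J -> fo I)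
    (a : nat -> world M) (b : nat -> state M) :
  fo_sat a b (fo_all F) <-> forall j, fo_sat a b (F j).
Proof.
have foldP (s : seq J) :
    fo_sat a b (foldr (fun j => FAnd (F j)) (FImp FBot FBot) s) <->
    forall j, j \in s -> fo_sat a b (F j).
  elim: s => [|j s IHs] /=; first by split.
  rewrite IHs; split=> [[Fj Fs] k|Fs].
    by rewrite inE => /predU1P[->|/Fs].
  by split=> [|k ks]; apply: Fs; rewrite inE ?eqxx ?ks ?orbT.
rewrite foldP; split=> Fs j; last by move=> _; apply: Fs.
by apply: Fs; rewrite mem_enum.
Qed.

Lemma fo_sat_any (M : rel_model I) (J : finType) (F : J -> fo I)
    (a : nat -> world M) (b : nat -> state M) :
  fo_sat a b (fo_any F) <-> exists j, fo_sat a b (F j).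
Proof.
have foldP (s : seq J) : fo_sat a b (foldr (fun j => FOr (F j)) FBot s) <->
    exists2 j, j \in s & fo_sat a b (F j).
  elim: s => [|j s IHs] /=; first by split=> // -[].
  rewrite IHs; split=> [[Fj|[k ks Fk]]|[k]].
  - by exists j; rewrite ?inE ?eqxx.
  - by exists k; rewrite ?inE ?ks ?orbT.
  - by rewrite inE => /predU1P[->|ks] Fk; [left|right; exists k].
rewrite foldP; split=> [[j _ Fj]|[j Fj]]; first by exists j.
by exists j; rewrite ?mem_enum.
Qed.

Lemma sub_nil_eq (s : seq nat) : {subset s <= [::]} -> s = [::].
Proof. by case: s => // z s /(_ z); rewrite inE eqxx => /(_ isT). Qed.

Definition fv_within (X Y : seq nat) (phi : fo I) : Prop :=
  {subset fvW phi <= X} /\ {subset fvS phi <= Y}.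

Lemma fv_within_all (X Y : seq nat) (J : finType) (F : J -> fo I) :
  (forall j, fv_within X Y (F j)) -> fv_within X Y (fo_all F).
Proof.
rewrite /fo_all => FX; elim: (enum J) => [|j s [IHX IHY]] //=.
by have [FjX FjY] := FX j; split=> z /=;
  rewrite mem_cat => /orP[]; auto.
Qed.

Lemma fv_within_any (X Y : seq nat) (J : finType) (F : J -> fo I) :
  (forall j, fv_within X Y (F j)) -> fv_within X Y (fo_any F).
Proof.
rewrite /fo_any => FX; elim: (enum J) => [|j s [IHX IHY]] //=.
by have [FjX FjY] := FX j; split=> z /=;
  rewrite mem_cat => /orP[]; auto.
Qed.

Definition holds_throughout (x y : nat) (alpha : fo I) : fo I :=
  FAllW x (FImp (Feps x y) alpha).

Lemma fv_within_throughout (x y : nat) (alpha : fo I) :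
  fv_within [:: x] [::] alpha ->
  fv_within [::] [:: y] (holds_throughout x y alpha).
Proof.
move=> [aX aY]; split=> z; rewrite /= ?eqxx /= ?mem_filter.
  by case/andP=> /negbTE zx /aX; rewrite inE zx.
by rewrite inE => /predU1P[->|/aY //]; rewrite inE.
Qed.

Lemma fo_sat_throughout (M : rel_model I) (x y : nat) (alpha : fo I)
    (a : nat -> world M) (b : nat -> state M) :
  fo_sat a b (holds_throughout x y alpha) <->
  forall w, members (b y) w -> fo_sat [eta a with x |-> w] b alpha.
Proof. by rewrite /= eqxx. Qed.

Lemma fv_within_ex_state (x : nat) (alpha : fo I) :
  fv_within [::] [:: 0] alpha ->
  fv_within [:: x] [::] (FAllS 0 (FImp (FE x 0) alpha)).
Proof.
move=> [aX aY]; split=> z; rewrite /= ?mem_filter.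
  by rewrite inE => /predU1P[->|/aX//]; rewrite inE.
by case/andP=> /negbTE z0 /aY; rewrite inE z0.
Qed.

(** A formula is asked for at every variable [x], so that [D] can be stated of whichever variable a
    surrounding quantifier binds, without renaming. Having no free state variable, it may stand
    under a quantifier that reuses the state variable [0]. *)
Definition fo_expressible (D : world_property I) : Prop :=
  forall x, exists2 F : fo I, fv_within [:: x] [::] F &
    forall (M : rel_model I) (a : nat -> world M) (b : nat -> state M),
      fo_sat a b F <-> D M (a x).

Lemma fo_expressible_imp (D D' : world_property I) :
  fo_expressible D -> fo_expressible D' ->
  fo_expressible (fun M w => D M w -> D' M w).
Proof.
move=> eD eD' x; have [F [F1 F2] FP] := eD x; have [G [G1 G2] GP] := eD' x.
exists (FImp F G) => [|M a b]; last by rewrite /= FP GP.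
by split=> z /=; rewrite mem_cat => /orP[]; auto.
Qed.

Lemma fo_expressible_and (D D' : world_property I) :
  fo_expressible D -> fo_expressible D' ->
  fo_expressible (fun M w => D M w /\ D' M w).
Proof.
move=> eD eD' x; have [F [F1 F2] FP] := eD x; have [G [G1 G2] GP] := eD' x.
exists (FAnd F G) => [|M a b]; last by rewrite /= FP GP.
by split=> z /=; rewrite mem_cat => /orP[]; auto.
Qed.

Lemma fo_expressible_all (J : finType) (D : J -> world_property I) :
  (forall j, fo_expressible (D j)) ->
  fo_expressible (fun M w => forall j, D j M w).
Proof.
move=> eD x; have /choice[F FP] : forall j, exists F, fv_within [:: x] [::] F /\
    forall M (a : nat -> world M) (b : nat -> state M),
      fo_sat a b F <-> D j M (a x).
  by move=> j; have [F ? ?] := eD j x; exists F.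
exists (fo_all F) => [|M a b]; first by apply: fv_within_all => j; case: (FP j).
by rewrite fo_sat_all; split=> Dw j; apply/(FP j).2/Dw.
Qed.

Lemma fo_expressible_any (J : finType) (D : J -> world_property I) :
  (forall j, fo_expressible (D j)) ->
  fo_expressible (fun M w => exists j, D j M w).
Proof.
move=> eD x; have /choice[F FP] : forall j, exists F, fv_within [:: x] [::] F /\
    forall M (a : nat -> world M) (b : nat -> state M),
      fo_sat a b F <-> D j M (a x).
  by move=> j; have [F ? ?] := eD j x; exists F.
exists (fo_any F) => [|M a b]; first by apply: fv_within_any => j; case: (FP j).
by rewrite fo_sat_any; split=> -[j Dw]; exists j; apply/(FP j).2/Dw.
Qed.

Lemma fo_expressible_successors (J : finType) (D : J -> world_property I) :
  (forall j, fo_expressible (D j)) ->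
  fo_expressible (fun M w => forall t, rel_E M w t ->
    exists j, forall v, members t v -> D j M v).
Proof.
move=> eD x; have /choice[F FP] : forall j, exists F,
    fv_within [:: x.+1] [::] F /\
    forall M (a : nat -> world M) (b : nat -> state M),
      fo_sat a b F <-> D j M (a x.+1).
  by move=> j; have [F ? ?] := eD j x.+1; exists F.
exists (FAllS 0 (FImp (FE x 0) (fo_any (fun j => holds_throughout x.+1 0 (F j))))).
  apply/fv_within_ex_state/fv_within_any => j.
  by apply: fv_within_throughout; case: (FP j).
move=> M a b; split=> /= Hw t.
  move=> /(Hw t)/fo_sat_any[j /fo_sat_throughout Fj]; exists j => v tv.
  by have /(FP j).2 /= := Fj v tv; rewrite eqxx.
move=> /Hw[j Dj]; apply/fo_sat_any; exists j; apply/fo_sat_throughout => v tv.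
by apply/(FP j).2; rewrite /= eqxx; apply: Dj.
Qed.

(* Box takes us to [sigma w], which need not be a state, so support is not
   translated directly: every formula is an inquisitive disjunction of
   truth-conditional ones (its resolutions), and those are evaluated worldwise. *)
Lemma resolutions (phi : inqml I) :
  exists (J : finType) (D : J -> world_property I),
    (forall j, fo_expressible (D j)) /\
    forall (M : rel_model I) (s : set (world M)),
      support (N := star M) s phi <-> exists j, forall w, s w -> D j M w.
Proof.
elim: phi => [i||p [J [D [eD DP]]] q [K [D' [eD' DP']]]
  |p [J [D [eD DP]]] q [K [D' [eD' DP']]]|p [J [D [eD DP]]] q [K [D' [eD' DP']]]
  |p [J [D [eD DP]]]|p [J [D [eD DP]]]].
- exists unit, (fun _ M w => rel_P M i w); split=> [_ x|M s] /=.
    by exists (FP i x) => //; split=> z.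
  by split=> [si|[_ si] w /si //]; exists tt.
- exists unit, (fun _ M w => False); split=> [_ x|M s] /=.
    by exists FBot => //; split=> z.
  split=> [->|[_ s0]]; first by exists tt.
  by rewrite -subset0 => w /s0.
- exists (J * K)%type, (fun jk M w => D jk.1 M w /\ D' jk.2 M w).
  split=> [[j k]|M s]; first exact: fo_expressible_and.
  rewrite /= DP DP'; split=> [[[j Dj] [k Dk]]|[[j k] /= H]].
    by exists (j, k) => w sw; split; [apply: Dj|apply: Dk].
  by split; [exists j => w /H[]|exists k => w /H[]].
(* A resolution of an implication assigns to each resolution of the antecedent one of the
   consequent. *)
- exists {ffun J -> K}, (fun (f : {ffun J -> K}) M w => forall j, D j M w -> D' (f j) M w).
  split=> [f|M s].
    by apply: fo_expressible_all => j; apply: fo_expressible_imp.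
  split=> /= [pq|[f Hf] t ts].
    have /choice[f Hf] : forall j, exists k, forall w, s w ->
        D j M w -> D' k M w.
      (* The worlds of [s] satisfying [D j] form the largest subset of [s] on which resolution [j]
         holds, so the [k] found for it serves all smaller ones. *)
      move=> j; have [|k Dk] := (DP' M [set w | s w /\ D j M w]).1.
      - apply: pq => [w []//|]; apply/DP; by exists j => w [].
      - by exists k => w sw Dw; apply: Dk; split.
    by exists [ffun j => f j] => w sw j; rewrite ffunE; apply: Hf.
  move=> /DP[j Dj]; apply/DP'; exists (f j) => w tw.
  by apply: Hf (Dj _ tw); apply: ts.
- exists (J + K)%type, (fun jk => match jk with inl j => D j | inr k => D' k end).
  split=> [[j|k] //|M s].
  rewrite /= DP DP'; split.
    by case=> -[j Hj]; [exists (inl j)|exists (inr j)].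
  by case=> -[j|j] Hj; [left|right]; exists j.
(* As [sigma w] is the union of the successor states, a resolution holds throughout it iff it holds
   throughout each of them; [j] is therefore chosen before [t], in contrast to [Boxplus]. The inner
   quantifier over [unit] only fits the shape of [fo_expressible_successors]. *)
- exists unit, (fun _ M w => exists j, forall t, rel_E M w t ->
    exists _ : unit, forall v, members t v -> D j M v); split=> [_|M s] /=.
    by apply: fo_expressible_any => j; apply: fo_expressible_successors.
  split=> [ps|[_ Hs] w sw].
    exists tt => w /ps /DP[j Dj]; exists j => t Ewt; exists tt => v tv.
    by apply: Dj; exists (members t) => //; exists t.
  have [j Dj] := Hs w sw; apply/DP; exists j => v [_ [t Ewt <-] tv].
  by have [_] := Dj t Ewt; apply.
- exists unit, (fun _ M w => forall t, rel_E M w t ->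
    exists j, forall v, members t v -> D j M v); split=> [_|M s] /=.
    exact: fo_expressible_successors.
  split=> [ps|[_ Hs] w sw _ [t Ewt <-]]; last exact/DP/(Hs _ sw).
  by exists tt => w sw t Ewt; apply/DP/(ps _ sw); exists t.
Qed.

Lemma support_down (phi : inqml I) (M : rel_model I) (s t : set (world M)) :
  t `<=` s -> support (N := star M) s phi -> support (N := star M) t phi.
Proof.
have [J [D [_ DP]]] := resolutions phi.
by move=> ts /DP[j Dj]; apply/DP; exists j => w /ts/Dj.
Qed.

Lemma support0 (phi : inqml I) (N : inq_model I) : support (N := N) set0 phi.
Proof.
elim: phi => //= [i|p _ q Hq t|p Hp q _]; [exact: sub0set| |by left].
by rewrite subset0 => ->.
Qed.

Lemma inqml_world_fo_definable (C : model_class) (P : world_property I) :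
  world_inqml_definable C P -> world_fo_definable C P.
Proof.
move=> [phi phiP]; have [J [D [eD DP]]] := resolutions phi.
have [F [FX FY] FP] := fo_expressible_any eD 0.
exists F, 0; split=> // [|M w CM a b]; first exact: sub_nil_eq.
rewrite phiP // FP /= /true_at DP; split=> -[j Dj]; exists j; first exact: Dj.
by move=> _ ->.
Qed.

Lemma inqml_state_fo_definable (C : model_class) (P : state_property I) :
  state_inqml_definable C P -> state_fo_definable C P.
Proof.
move=> [phi phiP]; have [J [D [eD DP]]] := resolutions phi.
have /choice[F FP] : forall j, exists F, fv_within [:: 0] [::] F /\
    forall M (a : nat -> world M) (b : nat -> state M),
      fo_sat a b F <-> D j M (a 0).
  by move=> j; have [F ? ?] := eD j 0; exists F.
have [FX FY] : fv_within [::] [:: 0] (fo_any (fun j => holds_throughout 0 0 (F j))).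
  apply: fv_within_any => j.
  by apply: fv_within_throughout; case: (FP j).
exists (fo_any (fun j => holds_throughout 0 0 (F j))), 0.
split=> // [|M s CM a b]; first exact: sub_nil_eq.
rewrite phiP // DP fo_sat_any.
split=> -[j Dj]; exists j; last first.
  by move=> w /((fo_sat_throughout _ _ _ _ _).1 Dj)/(FP j).2.
by apply/fo_sat_throughout => w /= sw; apply/(FP j).2/Dj.
Qed.

End Translation.

(** * Bisimulations *)

Section Bisimulation.
Variables (I : Type) (N N' : inq_model I).

Lemma winning_move (p0 : position N N') (c : challenge N N') :
  II_wins p0 -> moveI p0 c -> exists2 p, moveII c p & II_wins p.
Proof.
move=> [f f_wins] p0c; have [_ /(_ c p0c) cf] := f_wins _ _ (PlayStart f p0).
(* Histories list the latest choice first, so the strategy for the rest of the play consults [f] on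
   the history with [c] appended at the end. *)
exists (f [:: c]) => //; exists (fun h => f (rcons h c)) => h q play_q.
suff /f_wins[] : play f p0 (rcons h c) q by split.
elim: play_q => [|h' q' c' _ IH q'c'] /=.
  exact: (PlayRound (PlayStart f p0)).
exact: PlayRound IH q'c'.
Qed.

Lemma winning_positions (Z : position N N' -> Prop) :
  (forall p, Z p -> atoms_agree p) ->
  (forall p c, Z p -> moveI p c -> exists2 q, moveII c q & Z q) ->
  forall p, Z p -> II_wins p.
Proof.
move=> Zatoms Zmove p0 Zp0.
(* Legality of an answer depends on the challenge alone, so one [g c] serves all positions of [Z]
   where [c] can be played, and the strategy needs no memory. The value [p0] is a default for
   challenges that never arise. *)
have /choice[g gP] : forall c, exists q, forall p, Z p -> moveI p c ->
    moveII c q /\ Z q.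
  move=> c; have [[p [Zp pc]]|noZ] := pselect (exists p, Z p /\ moveI p c).
    by have [q cq Zq] := Zmove _ _ Zp pc; exists q.
  by exists p0 => p Zp pc; case: noZ; exists p.
exists (fun h => if h is c :: _ then g c else p0) => h p play_p.
suff Zp : Z p by split=> [|c pc]; [exact: Zatoms|case: (gP _ _ Zp pc)].
elim: play_p => // h' q c _ Zq qc /=.
by case: (gP _ _ Zq qc).
Qed.

Definition bisimilar (w : iworld N) (w' : iworld N') : Prop :=
  II_wins (WorldPos w w').

Definition matched (Z : iworld N -> iworld N' -> Prop)
    (s : set (iworld N)) (s' : set (iworld N')) : Prop :=
  (forall w, s w -> exists2 w', s' w' & Z w w') /\
  (forall w', s' w' -> exists2 w, s w & Z w w').

Record bisimulation (Z : iworld N -> iworld N' -> Prop) : Prop := Bisimulation {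
  bisim_atoms : forall w w', Z w w' -> forall i, ival N i w <-> ival N' i w';
  bisim_forth : forall w w' s, Z w w' -> Sigma N w s ->
    exists2 s', Sigma N' w' s' & matched Z s s';
  bisim_back : forall w w' s', Z w w' -> Sigma N' w' s' ->
    exists2 s, Sigma N w s & matched Z s s'
}.

Lemma bisimulation_bisimilar (Z : iworld N -> iworld N' -> Prop) :
  bisimulation Z -> forall w w', Z w w' -> bisimilar w w'.
Proof.
move=> [Zatoms Zforth Zback] w w'.
pose ZZ p := match p with WorldPos w w' => Z w w' | StatePos s s' => matched Z s s' end.
apply: (@winning_positions ZZ _ _ (WorldPos w w')) => [[u u' /Zatoms|]//|p c Zp pc].
move: Zp; case: p c / pc => [u u' s us|u u' s' us'|s s' u su|s s' u' su'] Zp.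
- by have [s' us' ss'] := Zforth _ _ _ Zp us; exists (StatePos s s') => //; constructor.
- by have [s us ss'] := Zback _ _ _ Zp us'; exists (StatePos s s') => //; constructor.
- by have [u' su' uu'] := Zp.1 _ su; exists (WorldPos u u') => //; constructor.
- by have [u su uu'] := Zp.2 _ su'; exists (WorldPos u u') => //; constructor.
Qed.

Lemma winning_state (s : set (iworld N)) (s' : set (iworld N')) :
  II_wins (StatePos s s') -> matched bisimilar s s'.
Proof.
move=> win; split=> [w sw|w' sw'].
  have [p cp wp] := winning_move win (MoveI_WorldL _ sw).
  by inversion cp; subst; exists w'.
have [p cp wp] := winning_move win (MoveI_WorldR _ sw').
by inversion cp; subst; exists w.
Qed.

Lemma bisimilar_bisimulation : bisimulation bisimilar.
Proof.
split=> [w w' [f f_wins]|w w' s win ws|w w' s' win ws'].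
- by have [] := f_wins _ _ (PlayStart f _).
- have [p cp wp] := winning_move win (MoveI_StateL _ ws).
  by inversion cp; subst; exists s' => //; apply: winning_state.
- have [p cp wp] := winning_move win (MoveI_StateR _ ws').
  by inversion cp; subst; exists s => //; apply: winning_state.
Qed.

Lemma support_bisimilar (phi : inqml I) (s : set (iworld N)) (s' : set (iworld N')) :
  matched bisimilar s s' -> support s phi <-> support s' phi.
Proof.
have [Batoms Bforth Bback] := bisimilar_bisimulation.
elim: phi s s' => [i||p IHp q IHq|p IHp q IHq|p IHp q IHq|p IHp|p IHp] s s' ss'; rewrite /=.
- split=> Vs w sw.
    by have [u su /Batoms uw] := ss'.2 w sw; apply/uw/Vs.
  by have [u su /Batoms uw] := ss'.1 w sw; apply/uw/Vs.
- split=> s0; rewrite -subset0 => w sw.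
    by have [u] := ss'.2 w sw; rewrite s0.
  by have [u] := ss'.1 w sw; rewrite s0.
- by rewrite (IHp _ _ ss') (IHq _ _ ss').
- split=> pq t ts tp.
    (* A subset of [s'] is pulled back to the worlds of [s] that have a bisimilar partner in it;
       since [s] and [s'] match, so do [u] and [t]. *)
    pose u := [set w | s w /\ exists2 w', t w' & bisimilar w w'].
    have ut : matched bisimilar u t.
      split=> [w [_ []] //|w' tw']; first by move=> w' ? ?; exists w'.
      have [w sw ww'] := ss'.2 _ (ts _ tw'); exists w => //.
      by split=> //; exists w'.
    by apply/(IHq _ _ ut)/pq; [move=> w []|apply/(IHp _ _ ut)].
  pose u := [set w' | s' w' /\ exists2 w, t w & bisimilar w w'].
  have tu : matched bisimilar t u.
    split=> [w tw|w' [_ [w]]]; last by exists w.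
    have [w' sw' ww'] := ss'.1 _ (ts _ tw); exists w' => //.
    by split=> //; exists w.
  by apply/(IHq _ _ tu)/pq; [move=> w []|apply/(IHp _ _ tu)].
- by rewrite (IHp _ _ ss') (IHq _ _ ss').
- have sigmaP w w' : bisimilar w w' -> matched bisimilar (sigma w) (sigma w').
    move=> ww'; split=> [v [t wt tv]|v' [t' wt' tv']].
      have [t' wt' [tt' _]] := Bforth _ _ _ ww' wt.
      by have [v' tv' vv'] := tt' _ tv; exists v' => //; exists t'.
    have [t wt [_ tt']] := Bback _ _ _ ww' wt'.
    by have [v tv vv'] := tt' _ tv'; exists v => //; exists t.
  split=> ps w sw.
    by have [u su uw] := ss'.2 w sw; apply/(IHp _ _ (sigmaP _ _ uw))/ps.
  by have [u su uw] := ss'.1 w sw; apply/(IHp _ _ (sigmaP _ _ uw))/ps.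
- split=> ps w sw t wt.
    have [u su uw] := ss'.2 w sw; have [v uv vt] := Bback _ _ _ uw wt.
    exact/(IHp _ _ vt)/(ps _ su).
  have [u su uw] := ss'.1 w sw; have [v uv vt] := Bforth _ _ _ uw wt.
  exact/(IHp _ _ vt)/(ps _ su).
Qed.

End Bisimulation.

Lemma inqml_world_bisim_invariant (C : model_class) (I : Type)
    (P : world_property I) :
  world_inqml_definable C P -> world_bisim_invariant C P.
Proof.
move=> [phi phiP] M M' w w' CM CM' ww'; rewrite !phiP //.
by apply: support_bisimilar; split=> _ ->; [exists w'|exists w].
Qed.

Lemma inqml_state_bisim_invariant (C : model_class) (I : Type)
    (P : state_property I) :
  state_inqml_definable C P -> state_bisim_invariant C P.
Proof.
by move=> [phi phiP] M M' s s' CM CM' ss'; rewrite !phiP //; apply: support_bisimilar.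
Qed.

(** * Types of finite depth *)

Section Types.
Variables (I : Type) (J : finType) (A : J -> I).

(** These are the candidate classes of [k]-step bisimilarity for the atoms in [A]: a truth
    assignment together with the family of type sets realized by the allowed states. Being finite
    types, they admit conjunctions and disjunctions over all classes. *)
Fixpoint ktype (k : nat) : finType :=
  if k is k'.+1 then ({ffun J -> bool} * {set {set ktype k'}})%type
  else {ffun J -> bool}.

Definition type_set (N : inq_model I) (k : nat) (tp : iworld N -> ktype k)
    (s : set (iworld N)) : {set ktype k} :=
  finset (fun tau => `[< exists2 w, s w & tp w = tau >]).

Fixpoint world_type (N : inq_model I) (k : nat) : iworld N -> ktype k :=
  match k with
  | 0 => fun w => [ffun j => `[< ival N (A j) w >]]
  | k'.+1 => fun w =>
      ([ffun j => `[< ival N (A j) w >]],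
       finset (fun X => `[< exists2 s, Sigma N w s &
                              type_set (@world_type N k') s = X >]))
  end.

Definition state_type (N : inq_model I) (k : nat) (s : set (iworld N)) :
  {set ktype k} := type_set (@world_type N k) s.

Lemma state_typeP (N : inq_model I) (k : nat) (s : set (iworld N)) tau :
  reflect (exists2 w, s w & world_type k w = tau) (tau \in state_type k s).
Proof. by rewrite finset.in_set; apply: asboolP. Qed.

Lemma sub_state_type (N : inq_model I) (k : nat) (s : set (iworld N)) (X : {set ktype k}) :
  (state_type k s \subset X) <-> forall w, s w -> world_type k w \in X.
Proof.
split=> [/fintype.subsetP sX w sw|sX]; first by apply/sX/state_typeP; exists w.
by apply/fintype.subsetP => _ /state_typeP[w sw <-]; apply: sX.
Qed.

Lemma world_type_succP (N : inq_model I) (k : nat) (w : iworld N) (X : {set ktype k}) :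
  reflect (exists2 s, Sigma N w s & state_type k s = X)
          (X \in (world_type k.+1 w).2).
Proof. by rewrite finset.in_set; apply: asboolP. Qed.

Lemma world_type_atoms (N N' : inq_model I) (k : nat) (w : iworld N) (w' : iworld N') :
  world_type k w = world_type k w' ->
  forall j, ival N (A j) w <-> ival N' (A j) w'.
Proof.
have ffP : [ffun j => `[< ival N (A j) w >]] = [ffun j => `[< ival N' (A j) w' >]] ->
    forall j, ival N (A j) w <-> ival N' (A j) w'.
  move=> /ffunP + j => /(_ j); rewrite !ffunE; apply: asbool_eq_equiv.
by case: k => [|k] => [/ffP|[/ffP]].
Qed.

Lemma world_type_succ (N N' : inq_model I) (k : nat) (w : iworld N) (w' : iworld N')
    (s : set (iworld N)) :
  world_type k.+1 w = world_type k.+1 w' -> Sigma N w s ->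
  exists2 s', Sigma N' w' s' & state_type k s' = state_type k s.
Proof.
move=> ww' ws; apply/world_type_succP; rewrite -ww'.
by apply/world_type_succP; exists s.
Qed.

(** The type of a world depends only on what is reachable from it, and [e] carries this over
    exactly. It serves the two injections into a disjoint union. *)
Lemma world_type_embedding (N N' : inq_model I) (e : iworld N -> iworld N') :
  (forall w i, ival N' i (e w) <-> ival N i w) ->
  (forall w t, Sigma N' (e w) t <-> exists2 s, Sigma N w s & e @` s = t) ->
  forall k w, world_type k (e w) = world_type k w.
Proof.
move=> e_atoms e_Sigma.
have atE w : [ffun j => `[< ival N' (A j) (e w) >]] = [ffun j => `[< ival N (A j) w >]].
  by apply/ffunP => j; rewrite !ffunE; apply/asbool_equiv_eq.
elim=> [|k IHk] w /=; rewrite atE //; congr pair; apply/setP => X; rewrite !finset.in_set.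
have imE s : state_type k (e @` s) = state_type k s.
  apply/setP => tau; apply/state_typeP/state_typeP => [[_ [v sv <-]]|[v sv]].
    by rewrite IHk; exists v.
  by rewrite -IHk; exists (e v) => //; exists v.
apply/asbool_equiv_eq; split=> [[t /e_Sigma[s ws <-] <-]|[s ws <-]].
  by exists s => //; apply/esym/imE.
by exists (e @` s); [apply/e_Sigma; exists s|exact: imE].
Qed.

(** * InqML formulae for types of finite depth *)

Definition inq_any (K : finType) (phi : K -> inqml I) : inqml I :=
  foldr (fun k => InqOr (phi k)) Bot (enum K).

Lemma support_any (N : inq_model I) (K : finType) (phi : K -> inqml I) (s : set (iworld N)) :
  support s (inq_any phi) <-> s = set0 \/ exists k, support s (phi k).
Proof.
have foldP (r : seq K) : support s (foldr (fun k => InqOr (phi k)) Bot r) <->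
    s = set0 \/ exists2 k, k \in r & support s (phi k).
  elim: r => [|k r IHr] /=; first by split; [left|case=> // -[]].
  rewrite IHr; split=> [[sk|[->|[l lr sl]]]|[->|[l]]].
  - by right; exists k; rewrite ?inE ?eqxx.
  - by left.
  - by right; exists l; rewrite ?inE ?lr ?orbT.
  - by right; left.
  - by rewrite inE => /predU1P[->|lr] sl; [left|right; right; exists l].
rewrite foldP; split=> -[->|[k]]; [by left|by right; exists k|by left|].
by right; exists k; rewrite ?mem_enum.
Qed.

(** These are the truth-conditional properties. They are closed under classical negation, so types
    can be described worldwise by Boolean combinations. *)
Definition declarative (D : forall N : inq_model I, iworld N -> Prop) : Prop :=
  exists phi : inqml I, forall (N : inq_model I) (s : set (iworld N)),
    support s phi <-> forall w, s w -> D N w.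

Lemma declarative_ext (D D' : forall N : inq_model I, iworld N -> Prop) :
  (forall N w, D N w <-> D' N w) -> declarative D -> declarative D'.
Proof.
move=> DD' [phi phiP]; exists phi => N s; rewrite phiP.
by split=> Ds w /Ds /DD'.
Qed.

Lemma declarative_atom (i : I) : declarative (fun N w => ival N i w).
Proof. by exists (Atom i). Qed.

Lemma declarative_false : declarative (fun N w => False).
Proof.
exists Bot => N s /=; rewrite -subset0.
by split=> s0 w /s0.
Qed.

Lemma declarative_and (D D' : forall N : inq_model I, iworld N -> Prop) :
  declarative D -> declarative D' -> declarative (fun N w => D N w /\ D' N w).
Proof.
move=> [phi phiP] [psi psiP]; exists (And phi psi) => N s /=; rewrite phiP psiP.
by split=> [[Ds D's] w sw|DD']; split; [exact: Ds|exact: D's|move=> w /DD'[]..].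
Qed.

Lemma declarative_imp (D D' : forall N : inq_model I, iworld N -> Prop) :
  declarative D -> declarative D' -> declarative (fun N w => D N w -> D' N w).
Proof.
move=> [phi phiP] [psi psiP]; exists (Imp phi psi) => N s /=; split=> [DD' w sw Dw|DD' t ts].
  apply: ((psiP _ _).1 (DD' [set w] _ _)) => [_ -> //||//].
  by apply/phiP => _ ->.
by move=> /phiP Dt; apply/psiP => w tw; apply: DD'; [apply: ts|apply: Dt].
Qed.

Lemma declarative_not (D : forall N : inq_model I, iworld N -> Prop) :
  declarative D -> declarative (fun N w => ~ D N w).
Proof. by move=> /declarative_imp; apply; apply: declarative_false. Qed.

Lemma declarative_all (K : finType) (D : K -> forall N : inq_model I, iworld N -> Prop) :
  (forall k, declarative (D k)) -> declarative (fun N w => forall k, D k N w).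
Proof.
move=> dD; suff dr (r : seq K) : declarative (fun N w => forall k, k \in r -> D k N w).
  apply: declarative_ext (dr (enum K)) => N w.
  by split=> Dw k; [apply: Dw; rewrite mem_enum|move=> _; apply: Dw].
elim: r => [|k r IHr].
  by apply: declarative_ext (declarative_not declarative_false) => N w; split=> // _ k.
apply: declarative_ext (declarative_and (dD k) IHr) => N w.
split=> [[Dk Dr] l|Dw]; first by rewrite inE => /predU1P[->|/Dr].
by split=> [|l lr]; apply: Dw; rewrite inE ?eqxx ?lr ?orbT.
Qed.

(** [Boxplus] inspects the worlds of a state one at a time, so it makes even an inquisitive
    disjunction truth-conditional. The alternative [t = set0] comes from the final [Bot] of
    [inq_any]. *)
Lemma declarative_boxplus (K : finType) (D : K -> forall N : inq_model I, iworld N -> Prop) :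
  (forall k, declarative (D k)) ->
  declarative (fun N w => forall t, Sigma N w t ->
    t = set0 \/ exists k, forall v, t v -> D k N v).
Proof.
move=> /choice[phi phiP]; exists (Boxplus (inq_any phi)) => N s /=.
split=> Hs w sw t wt; have := Hs w sw t wt; rewrite support_any;
  by case=> [->|[k /phiP kt]]; [left|right; exists k].
Qed.

Lemma declarative_iff (D : forall N : inq_model I, iworld N -> Prop) (b : bool) :
  declarative D -> declarative (fun N w => D N w <-> b).
Proof.
case: b => [|/declarative_not]; apply: declarative_ext => N w.
  by split=> [Dw|->].
by split=> [nD|[Df _] Dw]; [split=> [/nD|]|have := Df Dw].
Qed.

(** A classical disjunction over [X] is obtained as the conjunction, over all values outside [X], of
    their negations. *)
Lemma declarative_mem (T : finType) (tp : forall N : inq_model I, iworld N -> T)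
    (X : {set T}) :
  (forall tau, declarative (fun N w => tp N w = tau)) ->
  declarative (fun N w => tp N w \in X).
Proof.
move=> d_eq; have d_all : declarative (fun N w => forall tau, tau \notin X -> tp N w <> tau).
  apply: declarative_all => tau.
  have [tauX|tauX] := boolP (tau \in X); last first.
    by apply: declarative_ext (declarative_not (d_eq tau)) => N w; split; auto.
  by apply: declarative_ext (declarative_not declarative_false) => N w; split=> // _ k.
apply: declarative_ext d_all => N w; split=> [Dw|wX tau tauX wtau].
  by apply: contraT => /Dw.
by rewrite -wtau wX in tauX.
Qed.

(* A nonempty set [X] of types is realized by a member of the downward closed
   set [Sigma w] unless every member of [Sigma w] omits some type in [X]. *)
Lemma declarative_mem_succ (k : nat) (X : {set ktype k}) :
  (forall Y : {set ktype k}, declarative (fun N w => world_type k w \in Y)) ->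
  declarative (fun N w => X \in (world_type k.+1 w).2).
Proof.
move=> dk; have [->|X0] := eqVneq X finset.set0.
  apply: declarative_ext (declarative_not declarative_false) => N w; split=> [_|_ []].
  have [s ws] := Sigma_nonempty w.
  apply/world_type_succP; exists set0; first exact: Sigma_down ws (@sub0set _ _).
  by apply/eqP; rewrite -finset.subset0; apply/sub_state_type.
(* For [tau] outside [X] this set is empty, so the disjunction over all types offers a nonempty
   state only the types in [X]. *)
pose omits (tau : ktype k) := finset (fun rho => (tau \in X) && (rho != tau)).
have d_omits := declarative_boxplus (D := fun tau N w => world_type k w \in omits tau)
  (fun tau => dk (omits tau)).
apply: declarative_ext (declarative_not d_omits) => N w; split=> [some|/world_type_succP[s ws sX] all].
  apply/world_type_succP; apply: contrapT => noX; apply: some => t wt.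
  right; have [Xt|/fintype.subsetPn[tau tauX taut]] := boolP (X \subset state_type k t).
    (* A state realizing at least the types in [X] is cut down to one realizing exactly these. *)
    case: noX; exists [set v | t v /\ world_type k v \in X].
      by apply: Sigma_down wt _ => v [].
    apply/setP => tau; apply/state_typeP/idP => [[v [_ vX] <-] //|tauX].
    have /state_typeP[v tv vtau] := fintype.subsetP Xt _ tauX.
    by exists v => //; split=> //; rewrite vtau.
  exists tau => v tv; rewrite finset.in_set tauX /=.
  by apply: contraNneq taut => vtau; apply/state_typeP; exists v.
have [s0|[tau omit]] := all s ws.
  have [tau tauX] := set0Pn _ X0.
  by move: tauX; rewrite -sX => /state_typeP[v]; rewrite s0.
have [tauX|tauX] := boolP (tau \in X).
  move: (tauX); rewrite -sX => /state_typeP[v sv vtau].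
  by have := omit v sv; rewrite finset.in_set vtau eqxx andbF.
have [rho rhoX] := set0Pn _ X0.
move: rhoX; rewrite -sX => /state_typeP[v sv _].
by have := omit v sv; rewrite finset.in_set (negbTE tauX).
Qed.

Lemma declarative_world_type (k : nat) (X : {set ktype k}) :
  declarative (fun N w => world_type k w \in X).
Proof.
have d_atoms (f : {ffun J -> bool}) :
    declarative (fun N w => [ffun j => `[< ival N (A j) w >]] = f).
  have d_j := declarative_all (fun j => declarative_iff (f j) (declarative_atom (A j))).
  apply: declarative_ext d_j => N w.
  split=> [wf|<- j]; last by rewrite ffunE; apply: rwP; apply: asboolP.
  by apply/ffunP => j; rewrite ffunE; apply/asboolP/idP => /wf.
elim: k X => [|k IHk] X; apply: declarative_mem => tau; first exact: d_atoms.
have d_succ := declarative_all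
  (D := fun Y N w => Y \in (world_type k.+1 w).2 <-> Y \in tau.2)
  (fun Y => declarative_iff (Y \in tau.2) (declarative_mem_succ Y IHk)).
apply: declarative_ext (declarative_and (d_atoms tau.1) d_succ) => N w.
split=> [[wtau1 wtau2]|<-] //.
rewrite [tau]surjective_pairing -wtau1; congr pair; apply/setP => Y.
by apply/idP/idP => /wtau2.
Qed.

End Types.

(** * The layered companion *)

Lemma finite_powerset (T : Type) :
  finite_set [set: T] -> finite_set [set: set T].
Proof.
move=> /(@finite_seqP {classic T})[s sT].
pose f (m : {ffun 'I_(size s) -> bool}) : set T :=
  [set x | exists2 i, m i & tnth (in_tuple s) i = x].
have : finite_set (range f) by apply: finite_image; apply: finite_finset.
apply: sub_finite_set => X _; exists [ffun i => `[< X (tnth (in_tuple s) i) >]] => //.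
apply/seteqP; split=> x; first by move=> [i]; rewrite ffunE => /asboolP + <-.
move=> Xx; have /(tnthP (in_tuple s))[i xi] : (x : {classic T}) \in s.
  by have : [set` s] x by rewrite -sT.
by exists i; rewrite // ffunE; apply/asboolP; rewrite -xi.
Qed.

Section Layers.
Variables (I : Type) (J : finType) (A : J -> I) (U : inq_model I) (l : nat).

Notation wtype := (world_type A).

Definition lworld : Type := ('I_l.+1 * (iworld U * iworld U))%type.

Definition layer (u : lworld) : nat := u.1.

(** Each layer uses up one step, so at layer [k] agreement is required only for the remaining
    [l - k] steps. *)
Definition paired (u : lworld) : Prop :=
  wtype (l - layer u) u.2.1 = wtype (l - layer u) u.2.2.

(** Confining a state to one layer also ensures that a state quantifier names points of a single
    layer, just as a world quantifier does. *)
Definition lstate : Type :=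
  {t : set lworld | exists k, forall u, t u -> layer u = k}.

(** The minimum lets the last layer see itself, so that a play can go on forever. No depth of
    agreement remains there, and the second component is left unconstrained. *)
Definition lE (u : lworld) (t : lstate) : Prop :=
  [/\ forall v, sval t v -> layer v = minn (layer u).+1 l /\ paired v,
      Sigma U u.2.1 [set v.2.1 | v in sval t] &
      layer u < l -> Sigma U u.2.2 [set v.2.2 | v in sval t]].

Definition leps (u : lworld) (t : lstate) : Prop := sval t u.

(* Atoms are switched off at the pairs that do not matter, so that on every
   world the atoms in [A] are insensitive to exchanging the two components. *)
Definition lP (i : I) : set lworld := [set u | paired u /\ ival U i u.2.1].

Lemma lstate_ext (t t' : lstate) : sval t = sval t' -> t = t'.
Proof.
case: t t' => [t tk] [t' tk'] /= tt'; move: tk'; rewrite -tt' => tk'.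
by congr exist; apply: Prop_irrelevance.
Qed.

Definition mk_lstate (k : nat) (t : set lworld)
    (tk : forall u, t u -> layer u = k) : lstate :=
  exist _ t (ex_intro _ k tk).

Lemma lE_nonempty (u : lworld) : exists t, lE u t.
Proof.
have Sigma0 w : Sigma U w set0.
  by have [s ws] := Sigma_nonempty w; apply: Sigma_down ws (@sub0set _ _).
have t0 v : (set0 : set lworld) v -> layer v = 0 by [].
by exists (mk_lstate t0); split=> [//||_] /=; rewrite image_set0.
Qed.

Lemma lE_down (u : lworld) (s s' : lstate) :
  lE u s -> extent leps s' `<=` extent leps s -> lE u s'.
Proof.
move=> [s1 s2 s3] ss'; split=> [v /ss'/s1 //||/s3 s4].
  by apply: Sigma_down s2 _ => _ [v /ss' sv <-]; exists v.
by apply: Sigma_down s4 _ => _ [v /ss' sv <-]; exists v.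
Qed.

Lemma lpowerset (s : lstate) (t : set lworld) :
  t `<=` extent leps s -> exists s', extent leps s' = t.
Proof.
by case: s => s [k sk] ts; have tk u (tu : t u) := sk u (ts u tu); exists (mk_lstate tk).
Qed.

Variable u0 : iworld U.

Definition layered : rel_model I :=
  @RelModel I lworld lstate lE leps lP
    (inhabits (ord0, (u0, u0)))
    (inhabits (@mk_lstate 0 set0 (fun _ => False_ind _)))
    lstate_ext lpowerset lE_nonempty lE_down.

Lemma layered_locally_full : locally_full layered.
Proof.
move=> u t tE; have tk v : t v -> layer v = minn (layer u).+1 l.
  by move=> /tE[s [s1 _ _] /s1[]].
by exists (mk_lstate tk).
Qed.

Lemma layered_finite : finite_set [set: iworld U] -> finite_model layered.
Proof.
move=> finU; have finW : finite_set [set: lworld].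
  rewrite -setXTT; apply: finite_setX; first exact: finite_finset.
  by rewrite -setXTT; apply: finite_setX.
split=> //.
pose f (t : set lworld) : lstate :=
  if pselect (exists k, forall u, t u -> layer u = k) is left tk then exist _ t tk
  else @mk_lstate 0 set0 (fun _ => False_ind _).
have : finite_set (range f) by apply: finite_image; apply: finite_powerset.
apply: sub_finite_set => t _; exists (sval t) => //; rewrite /f.
case: pselect => [tk|]; last by case: (svalP t) => k tk; case; exists k.
exact: lstate_ext.
Qed.

Definition projects (u : lworld) (x : iworld U) : Prop := paired u /\ u.2.1 = x.

Lemma matched_projects (t : set lworld) (s : set (iworld U)) :
  (forall v, t v -> paired v) -> [set v.2.1 | v in t] = s ->
  @matched I (star layered) U projects t s.
Proof.
move=> pt <-; split=> [v tv|_ [v tv <-]].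
  by exists v.2.1; [exists v|split=> //; apply: pt].
by exists v => //; split=> //; apply: pt.
Qed.

(** Forth is built into [lE]. The content is back: a state allowed at the first component has to be
    lifted to a set of pairs whose second projection is allowed as well. *)
Lemma projection_bisimulation : @bisimulation I (star layered) U projects.
Proof.
split.
- by move=> u _ [pu <-] i; split=> [[]|].
- move=> u _ s [pu <-] [t [t1 t2 _] <-]; exists [set v.2.1 | v in sval t] => //.
  by apply: matched_projects => // v /t1[].
- move=> [k [y0 x']] x s [pu /= <-] xs.
  have [kl|lk] := ltnP k l.
    have lkS : l - k = (l - k.+1).+1 by rewrite subnSK.
    move: pu; rewrite /paired /layer /= lkS => xx'.
    have [s' xs' ss'] := world_type_succ xx' xs.
    (* All pairs of equal type from [s] and [s'] are taken; as the two states realize the same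
       types, both projections are onto. *)
    pose t := [set v : lworld | [/\ layer v = k.+1, paired v, s v.2.1 & s' v.2.2]].
    have tk v : t v -> layer v = k.+1 by case.
    have kl' : k.+1 < l.+1 by [].
    have t_s : [set v.2.1 | v in t] = s.
      apply/seteqP; split=> [_ [v [_ _ sv _] <-] //|y sy].
      have : wtype (l - k.+1) y \in state_type A (l - k.+1) s'.
        by rewrite ss'; apply/state_typeP; exists y.
      by case/state_typeP=> y' sy' yy'; exists (Ordinal kl', (y, y')).
    have t_s' : [set v.2.2 | v in t] = s'.
      apply/seteqP; split=> [_ [v [_ _ _ sv] <-] //|y' sy'].
      have : wtype (l - k.+1) y' \in state_type A (l - k.+1) s.
        by rewrite -ss'; apply/state_typeP; exists y'.
      by case/state_typeP=> y sy yy'; exists (Ordinal kl', (y, y')).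
    exists t; last by apply: matched_projects => // v [].
    exists (mk_lstate tk) => //; split=> /=; rewrite ?t_s ?t_s' // => v [vk pv _ _].
    by rewrite vk (minn_idPl _).
  have kl : k = l :> nat by apply/eqP; rewrite eqn_leq lk -ltnS ltn_ord.
  pose t := [set v : lworld | [/\ layer v = l, paired v & s v.2.1]].
  have tk v : t v -> layer v = l by case.
  have t_s : [set v.2.1 | v in t] = s.
    apply/seteqP; split=> [_ [v [_ _ sv] <-] //|y sy].
    (* In the last layer any paired second component will do, in particular the diagonal one. *)
    by exists (ord_max, (y, y)).
  exists t; last by apply: matched_projects => // v [].
  exists (mk_lstate tk) => //; split=> /=; rewrite ?t_s //.
    by move=> v [vk pv _]; rewrite vk /layer /= kl (minn_idPr _).
  by rewrite /layer /= kl ltnn.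
Qed.

(** * The exchange of components *)

Definition exchange (m : nat) (u : lworld) : lworld :=
  if layer u <= m then (u.1, (u.2.2, u.2.1)) else u.

Lemma layer_exchange (m : nat) (u : lworld) : layer (exchange m u) = layer u.
Proof. by rewrite /exchange; case: ifP. Qed.

Lemma exchangeK (m : nat) : involutive (exchange m).
Proof.
move=> u; rewrite {1}/exchange layer_exchange /exchange.
by case: (layer u <= m) => //=; case: u => k [].
Qed.

Lemma paired_exchange (m : nat) (u : lworld) : paired (exchange m u) <-> paired u.
Proof. by rewrite /exchange; case: ifP => // _; split=> /esym. Qed.

Lemma lP_exchange (m : nat) (j : J) (u : lworld) :
  lP (A j) (exchange m u) <-> lP (A j) u.
Proof.
rewrite /lP /= paired_exchange /exchange; case: ifP => // _ /=.
by split=> -[pu ju]; split=> //; apply/(world_type_atoms pu).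
Qed.

Definition exchange_state (m : nat) (t : lstate) : lstate.
Proof.
exists (exchange m @` sval t).
by have [k tk] := svalP t; exists k => _ [u tu <-]; rewrite layer_exchange; apply: tk.
Defined.

Lemma exchange_stateE (m : nat) (t : lstate) (u : lworld) :
  sval (exchange_state m t) (exchange m u) <-> sval t u.
Proof.
split=> [[v tv]|tu]; last by exists u.
by move=> /(can_inj (exchangeK m)) <-.
Qed.

Lemma exchange_stateK (m : nat) : involutive (exchange_state m).
Proof.
move=> t; apply: lstate_ext; rewrite /= image_comp.
have -> : exchange m \o exchange m = id by apply/funext => u; apply: exchangeK.
exact: image_id.
Qed.

(** For a world above layer [m], it and its successors stay fixed, also when it lies in the last
    layer. For a world below layer [m], both ends are exchanged; its layer is below [l], where [lE]
    treats the two components alike. *)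
Lemma lE_exchange_imp (m : nat) (u : lworld) (t : lstate) :
  m <= l -> layer u <> m ->
  lE u t -> lE (exchange m u) (exchange_state m t).
Proof.
move=> ml um [t1 t2 t3].
have um' : (layer u < m) || (m < layer u) by rewrite -neq_ltn; apply/eqP.
have [lt_um|gt_um] := orP um'; last first.
  have ul : layer u <= l by rewrite -ltnS; apply: ltn_ord.
  have -> : exchange m u = u by rewrite /exchange leqNgt gt_um.
  have -> // : exchange_state m t = t.
  apply: lstate_ext => /=; rewrite -[RHS]image_id; apply: eq_imagel => v /t1[vk _].
  by rewrite /exchange vk leqNgt leq_min ltnS (ltnW gt_um) (leq_trans gt_um ul).
have lt_ul := leq_trans lt_um ml.
have exv v : sval t v -> exchange m v = (v.1, (v.2.2, v.2.1)).
  by move=> /t1[vk _]; rewrite /exchange vk (minn_idPl lt_ul) lt_um.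
split; rewrite ?layer_exchange.
- by move=> _ [v /t1[vk pv] <-]; rewrite layer_exchange paired_exchange.
- rewrite /exchange ltnW //= image_comp.
  have <- // : [set v.2.2 | v in sval t] =
      ((fun v : lworld => v.2.1) \o exchange m) @` sval t.
    by apply: eq_imagel => v /exv /= ->.
  exact: t3.
- move=> _; rewrite /exchange ltnW //= image_comp.
  have <- // : [set v.2.1 | v in sval t] =
      ((fun v : lworld => v.2.2) \o exchange m) @` sval t.
  by apply: eq_imagel => v /exv /= ->.
Qed.

Lemma lE_exchange (m : nat) (u : lworld) (t : lstate) :
  m <= l -> layer u <> m ->
  lE (exchange m u) (exchange_state m t) <-> lE u t.
Proof.
move=> ml um; split; last exact: lE_exchange_imp.
rewrite -{2}[u](exchangeK m) -{2}[t](exchange_stateK m).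
by apply: lE_exchange_imp; rewrite ?layer_exchange.
Qed.

End Layers.

(** * Locality of first-order formulas *)

Section Locality.
Variable I : Type.

Fixpoint qrank (phi : fo I) : nat :=
  match phi with
  | FE _ _ | Feps _ _ | FP _ _ | FEqW _ _ | FEqS _ _ | FBot => 0
  | FAnd f g | FOr f g | FImp f g => maxn (qrank f) (qrank g)
  | FAllW _ f | FExW _ f | FAllS _ f | FExS _ f => (qrank f).+1
  end.

Fixpoint atoms_within (D : set I) (phi : fo I) : Prop :=
  match phi with
  | FP i _ => D i
  | FE _ _ | Feps _ _ | FEqW _ _ | FEqS _ _ | FBot => True
  | FAnd f g | FOr f g | FImp f g => atoms_within D f /\ atoms_within D g
  | FAllW _ f | FExW _ f | FAllS _ f | FExS _ f => atoms_within D f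
  end.

Lemma atoms_within_sub (D D' : set I) (phi : fo I) :
  D `<=` D' -> atoms_within D phi -> atoms_within D' phi.
Proof.
by move=> DD'; elim: phi => //= [i _ /DD' //|f IHf g IHg|f IHf g IHg|f IHf g IHg];
  case=> /IHf ? /IHg.
Qed.

Lemma atoms_finite (phi : fo I) :
  exists (J : finType) (A : J -> I), atoms_within (range A) phi.
Proof.
have noatoms : exists J : finType, exists A : J -> I, True.
  by exists void, (@of_void I).
have join f g : (exists (J : finType) (A : J -> I), atoms_within (range A) f) ->
    (exists (J : finType) (A : J -> I), atoms_within (range A) g) ->
    exists (J : finType) (A : J -> I), atoms_within (range A) f /\ atoms_within (range A) g.
  move=> [J [A Af]] [J' [A' A'g]].
  exists (J + J')%type, (fun j => match j with inl j => A j | inr j => A' j end).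
  split; [apply: atoms_within_sub Af|apply: atoms_within_sub A'g].
    by move=> _ [j _ <-]; exists (inl j).
  by move=> _ [j _ <-]; exists (inr j).
elim: phi => //= [i _|f IHf g IHg|f IHf g IHg|f IHf g IHg]; try exact: join; try exact: noatoms.
by exists unit, (fun=> i); exists tt.
Qed.

Variables (J : finType) (A : J -> I) (U : inq_model I) (l : nat) (u0 : iworld U).

Notation K := (layered A l u0).

Definition avoids (lo hi k : nat) : bool := (k < lo) || (hi <= k).

Definition assignment_avoids (lo hi : nat) (a : nat -> world K) (b : nat -> state K) : Prop :=
  (forall z, avoids lo hi (layer (a z))) /\
  (forall z u, sval (b z) u -> avoids lo hi (layer u)).

(** Below [lo] both maps swap the components; from [hi] on neither does. *)
Lemma exchange_avoids (lo hi m m' : nat) (u : lworld U l) :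
  avoids lo hi (layer u) -> lo <= m < hi -> lo <= m' < hi ->
  exchange m u = exchange m' u.
Proof.
rewrite /avoids /exchange => /orP[uk|uk] /andP[m1 m2] /andP[m1' m2'].
  by rewrite (ltnW (leq_trans uk m1)) (ltnW (leq_trans uk m1')).
by rewrite !(leqNgt (layer u)) (leq_trans m2 uk) (leq_trans m2' uk).
Qed.

Lemma exchange_state_avoids (lo hi m m' : nat) (t : lstate U l) :
  (forall u, sval t u -> avoids lo hi (layer u)) ->
  lo <= m < hi -> lo <= m' < hi ->
  exchange_state m t = exchange_state m' t.
Proof.
move=> tk mk mk'; apply: lstate_ext => /=; apply: eq_imagel => u /tk uk.
exact: exchange_avoids uk mk mk'.
Qed.

(** The range is cut at [lo + 2 ^ n], and [k] can lie in only one of the two parts. Halving at each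
    quantifier is why lengths are powers of two in the rank. *)
Lemma avoids_halve (n lo hi k : nat) : 2 ^ n.+1 <= hi - lo ->
  exists lo' hi', [/\ lo <= lo', hi' <= hi, 2 ^ n <= hi' - lo' & avoids lo' hi' k].
Proof.
have := expn_gt0 2 n; rewrite expnS /avoids /=; set p := 2 ^ n => p_gt0 le_p.
have [k_lt|k_ge] := ltnP k (lo + p).
  by exists (lo + p), hi; split; lia.
by exists lo, (lo + p); split; lia.
Qed.

Lemma leq_exp_maxn (p q n : nat) : 2 ^ maxn p q <= n -> 2 ^ p <= n /\ 2 ^ q <= n.
Proof.
by move=> pq_n; split; apply: leq_trans pq_n; rewrite leq_exp2l // leq_max leqnn ?orbT.
Qed.

Lemma avoids_sub (lo hi lo' hi' k : nat) :
  lo <= lo' -> hi' <= hi -> avoids lo hi k -> avoids lo' hi' k.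
Proof.
move=> lo1 hi1 /orP[k1|k1]; rewrite /avoids; first by rewrite (leq_trans k1).
by rewrite (leq_trans hi1 k1) orbT.
Qed.

(** The half of the range that avoids [k] supplies [m'], and on the points already named
    [exchange m'] equals [exchange m]. Since [m'] depends on the layer of [w] only, and
    [exchange m'] is an involution preserving layers, the equivalence can be used in both directions
    under a quantifier. *)
Lemma fo_sat_exchange_world (n lo hi m x : nat) (f : fo I)
    (a : nat -> world K) (b : nat -> state K) :
  (forall lo hi m (a : nat -> world K) (b : nat -> state K),
    2 ^ n <= hi - lo -> lo <= m < hi -> hi <= l.+1 -> assignment_avoids lo hi a b ->
    fo_sat a b f <-> fo_sat (M := K) (exchange m \o a) (exchange_state m \o b) f) ->
  2 ^ n.+1 <= hi - lo -> lo <= m < hi -> hi <= l.+1 -> assignment_avoids lo hi a b ->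
  forall k, exists m', forall w : world K, layer w = k ->
    fo_sat [eta a with x |-> w] b f <->
    fo_sat (M := K) [eta exchange m \o a with x |-> exchange m' w] (exchange_state m \o b) f.
Proof.
move=> IHf qr mk hil [ak bk] k.
have [lo' [hi' [lo1 hi1 qr' kk]]] := avoids_halve k qr.
have mk' : lo' <= lo' < hi' by rewrite leqnn -subn_gt0 (leq_trans _ qr') // expn_gt0.
have mk'' : lo <= lo' < hi.
  by rewrite lo1 (leq_trans _ hi1) //; case/andP: mk'.
exists lo' => w wk; rewrite (IHf lo' hi' lo') //; last 2 first.
- exact: leq_trans hi1 hil.
- split=> [z|z u zu] /=; last exact: avoids_sub lo1 hi1 (bk _ _ zu).
  by case: eqP => _; rewrite ?wk //; apply: avoids_sub lo1 hi1 (ak z).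
have -> : exchange lo' \o [eta a with x |-> w] =
          [eta exchange m \o a with x |-> exchange lo' w].
  apply/funext => z /=; case: eqP => // _; exact: exchange_avoids (ak z) mk'' mk.
have -> // : exchange_state lo' \o b = exchange_state m \o b.
by apply/funext => z /=; apply: exchange_state_avoids (bk z) mk'' mk.
Qed.

Lemma fo_sat_exchange_state (n lo hi m y : nat) (f : fo I)
    (a : nat -> world K) (b : nat -> state K) :
  (forall lo hi m (a : nat -> world K) (b : nat -> state K),
    2 ^ n <= hi - lo -> lo <= m < hi -> hi <= l.+1 -> assignment_avoids lo hi a b ->
    fo_sat a b f <-> fo_sat (M := K) (exchange m \o a) (exchange_state m \o b) f) ->
  2 ^ n.+1 <= hi - lo -> lo <= m < hi -> hi <= l.+1 -> assignment_avoids lo hi a b ->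
  forall k, exists m', forall t : state K, (forall u, sval t u -> layer u = k) ->
    fo_sat (M := K) a [eta b with y |-> t] f <->
    fo_sat (M := K) (exchange m \o a) [eta exchange_state m \o b with y |-> exchange_state m' t] f.
Proof.
move=> IHf qr mk hil [ak bk] k.
have [lo' [hi' [lo1 hi1 qr' kk]]] := avoids_halve k qr.
have mk' : lo' <= lo' < hi' by rewrite leqnn -subn_gt0 (leq_trans _ qr') // expn_gt0.
have mk'' : lo <= lo' < hi.
  by rewrite lo1 (leq_trans _ hi1) //; case/andP: mk'.
exists lo' => t tk; rewrite (IHf lo' hi' lo') //; last 2 first.
- exact: leq_trans hi1 hil.
- split=> [z|z u] /=; first exact: avoids_sub lo1 hi1 (ak z).
  by case: eqP => _ zu; [rewrite (tk _ zu)|apply: avoids_sub lo1 hi1 (bk _ _ zu)].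
have -> : exchange_state lo' \o [eta b with y |-> t] =
          [eta exchange_state m \o b with y |-> exchange_state lo' t].
  by apply/funext => z /=; case: eqP => // _; apply: exchange_state_avoids (bk z) mk'' mk.
have -> // : exchange lo' \o a = exchange m \o a.
by apply/funext => z /=; apply: exchange_avoids (ak z) mk'' mk.
Qed.

(* As no point named by the assignment lies in the layers [lo, ..., hi - 1],
   the layer [m] up to which components are exchanged can be moved freely in
   that range; a quantified point leaves one half of the range untouched. *)
Lemma fo_sat_exchange (phi : fo I) (lo hi m : nat)
    (a : nat -> world K) (b : nat -> state K) :
  atoms_within (range A) phi ->
  2 ^ qrank phi <= hi - lo -> lo <= m < hi -> hi <= l.+1 ->
  assignment_avoids lo hi a b ->
  fo_sat a b phi <-> fo_sat (M := K) (exchange m \o a) (exchange_state m \o b) phi.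
Proof.
elim: phi lo hi m a b => [x y|x y|i x|x x'|y y'||f IHf g IHg|f IHf g IHg|f IHf g IHg
    |x f IHf|x f IHf|y f IHf|y f IHf] lo hi m a b /= phiA qr mk hil [ak bk].
(* This is the only atomic case that needs the named points to avoid the range: the edge relation is
   sensitive to the exchange exactly at worlds of layer [m]. *)
- have [ml xm] : m <= l /\ layer (a x) <> m by move: (ak x); rewrite /avoids; split; lia.
  exact: (iff_sym (lE_exchange A (b y) ml xm)).
- exact: (iff_sym (exchange_stateE m (b y) (a x))).
- by have [j _ <-] := phiA; exact: (iff_sym (lP_exchange A m j (a x))).
- by split=> [->|/(can_inj (@exchangeK _ U l m))].
- by split=> [->|/(can_inj (@exchange_stateK _ U l m))].
- by [].
- have [[fA gA] [qf qg]] := (phiA, leq_exp_maxn qr).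
  by rewrite (IHf _ _ _ _ _ fA qf mk hil (conj ak bk))
             (IHg _ _ _ _ _ gA qg mk hil (conj ak bk)).
- have [[fA gA] [qf qg]] := (phiA, leq_exp_maxn qr).
  by rewrite (IHf _ _ _ _ _ fA qf mk hil (conj ak bk))
             (IHg _ _ _ _ _ gA qg mk hil (conj ak bk)).
- have [[fA gA] [qf qg]] := (phiA, leq_exp_maxn qr).
  by rewrite (IHf _ _ _ _ _ fA qf mk hil (conj ak bk))
             (IHg _ _ _ _ _ gA qg mk hil (conj ak bk)).
- have step := fo_sat_exchange_world x (fun lo hi m a b => IHf lo hi m a b phiA) qr mk hil
    (conj ak bk).
  split=> af w; have [m' ww'] := step (layer w).
    rewrite -[w](exchangeK m'); apply/ww'; first by rewrite layer_exchange.
    exact: af.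
  by apply/(ww' w erefl); apply: af.
- have step := fo_sat_exchange_world x (fun lo hi m a b => IHf lo hi m a b phiA) qr mk hil
    (conj ak bk).
  split=> -[w af]; have [m' ww'] := step (layer w).
    by exists (exchange m' w); apply/(ww' w erefl).
  exists (exchange m' w); apply/ww'; first by rewrite layer_exchange.
  by rewrite exchangeK.
- have step := fo_sat_exchange_state y (fun lo hi m a b => IHf lo hi m a b phiA) qr mk hil
    (conj ak bk).
  split=> af t; have [k tk] := svalP t; have [m' tt'] := step k.
    rewrite -[t](exchange_stateK m'); apply/tt'; last exact: af.
    by move=> _ [u tu <-]; rewrite layer_exchange; apply: tk.
  by apply/(tt' t tk); apply: af.
- have step := fo_sat_exchange_state y (fun lo hi m a b => IHf lo hi m a b phiA) qr mk hil
    (conj ak bk).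
  split=> -[t af]; have [k tk] := svalP t; have [m' tt'] := step k.
    by exists (exchange_state m' t); apply/(tt' t tk).
  exists (exchange_state m' t); apply/tt'; last by rewrite exchange_stateK.
  by move=> _ [u tu <-]; rewrite layer_exchange; apply: tk.
Qed.

End Locality.

(** * Disjoint unions *)

Section Sum.
Variables (I : Type) (N N' : inq_model I).

Definition sum_Sigma (z : iworld N + iworld N') : set (set (iworld N + iworld N')) :=
  match z with
  | inl w => [set [set inl v | v in s] | s in Sigma N w]
  | inr w => [set [set inr v | v in s] | s in Sigma N' w]
  end.

Definition sum_val (i : I) : set (iworld N + iworld N') :=
  [set z | match z with inl w => ival N i w | inr w => ival N' i w end].

Lemma sum_Sigma_nonempty z : sum_Sigma z !=set0.
Proof.
by case: z => w; have [s ws] := Sigma_nonempty w; eexists; exists s.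
Qed.

Lemma sum_Sigma_down z s t : sum_Sigma z s -> t `<=` s -> sum_Sigma z t.
Proof.
case: z => w [s' ws' <-] ts.
  exists [set v | t (inl v)].
    by apply: Sigma_down ws' _ => v /ts [? ? [<-]].
  by apply/seteqP; split=> [_ [v tv <-]|z tz] //; have [v _ zv] := ts z tz; exists v; rewrite /= ?zv.
exists [set v | t (inr v)].
  by apply: Sigma_down ws' _ => v /ts [? ? [<-]].
by apply/seteqP; split=> [_ [v tv <-]|z tz] //; have [v _ zv] := ts z tz; exists v; rewrite /= ?zv.
Qed.

Definition sum_model : inq_model I := InqModel sum_val sum_Sigma_nonempty sum_Sigma_down.

Lemma inl_bisimulation : @bisimulation I sum_model N (fun z w => z = inl w).
Proof.
split=> [_ w -> //|_ w t -> [s ws <-]|_ w s -> ws].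
  exists s => //; split=> [_ [v sv <-]|v sv]; first by exists v.
  by exists (inl v) => //; exists v.
exists [set inl v | v in s]; first by exists s.
split=> [_ [v sv <-]|v sv]; first by exists v.
by exists (inl v) => //; exists v.
Qed.

Lemma inr_bisimulation : @bisimulation I sum_model N' (fun z w => z = inr w).
Proof.
split=> [_ w -> //|_ w t -> [s ws <-]|_ w s -> ws].
  exists s => //; split=> [_ [v sv <-]|v sv]; first by exists v.
  by exists (inr v) => //; exists v.
exists [set inr v | v in s]; first by exists s.
split=> [_ [v sv <-]|v sv]; first by exists v.
by exists (inr v) => //; exists v.
Qed.

End Sum.

Lemma matched_comp (I : Type) (N N' N'' : inq_model I)
    (Z : iworld N -> iworld N' -> Prop) (Z' : iworld N' -> iworld N'' -> Prop)
    (s : set (iworld N)) (s' : set (iworld N')) (s'' : set (iworld N'')) :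
  matched Z s s' -> matched Z' s' s'' ->
  matched (fun w w'' => exists2 w', Z w w' & Z' w' w'') s s''.
Proof.
move=> [ss' s's] [s's'' s''s']; split=> [w /ss'[w' /s's''[w'' sw'' w'w''] ww']|].
  by exists w'' => //; exists w'.
move=> w'' /s''s'[w' /s's[w sw ww'] w'w''].
by exists w => //; exists w'.
Qed.

Lemma bisimulation_comp (I : Type) (N N' N'' : inq_model I)
    (Z : iworld N -> iworld N' -> Prop) (Z' : iworld N' -> iworld N'' -> Prop) :
  bisimulation Z -> bisimulation Z' ->
  bisimulation (fun w w'' => exists2 w', Z w w' & Z' w' w'').
Proof.
move=> [Za Zf Zb] [Za' Zf' Zb']; split=> w w''.
- by move=> [w' /Za ww' /Za' w'w''] i; rewrite ww'.
- move=> s [w' ww' w'w''] ws; have [s' ws' ss'] := Zf _ _ _ ww' ws.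
  have [s'' ws'' s's''] := Zf' _ _ _ w'w'' ws'.
  by exists s'' => //; apply: matched_comp s's''.
- move=> s'' [w' ww' w'w''] ws''; have [s' ws' s's''] := Zb' _ _ _ w'w'' ws''.
  have [s ws ss'] := Zb _ _ _ ww' ws'.
  by exists s => //; apply: matched_comp s's''.
Qed.

(** * First-order definable invariant properties *)

Section Transfer.
Variables (C : model_class) (I : Type) (J : finType) (A : J -> I).
Variables (M M' : rel_model I) (l : nat) (w0 : world M).
Hypotheses (CM : in_class C M) (CM' : in_class C M').

Let U := sum_model (star M) (star M').
Let u0 : iworld U := inl w0.

Definition companion : rel_model I := @layered I J A U l u0.

Lemma companion_in_class : in_class C companion.
Proof.
have finK : finite_model M -> finite_model M' -> finite_model companion.
  move=> [finM _] [finM' _]; apply: layered_finite.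
  have -> : [set: iworld U] = range inl `|` range inr.
    by apply/seteqP; split=> // -[w|w] _; [left|right]; exists w.
  by rewrite finite_setU; split; apply: finite_image.
have full := @layered_locally_full I J A U l u0.
by case: C CM CM' => //= -[finM _] [finM' _]; split; [exact: finK|exact: full].
Qed.

Lemma world_type_inl k (w : world M) :
  world_type A k (inl w : iworld U) = world_type A k (w : iworld (star M)).
Proof.
by apply: (@world_type_embedding _ _ _ (star M) U inl) => // v t; split=> -[s ? <-]; exists s.
Qed.

Lemma world_type_inr k (w : world M') :
  world_type A k (inr w : iworld U) = world_type A k (w : iworld (star M')).
Proof.
by apply: (@world_type_embedding _ _ _ (star M') U inr) => // v t; split=> -[s ? <-]; exists s.
Qed.

Definition to_left (u : world companion) (w : world M) : Prop :=
  exists2 z, @projects I J A U l u z & z = inl w.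

Definition to_right (u : world companion) (w : world M') : Prop :=
  exists2 z, @projects I J A U l u z & z = inr w.

Lemma to_left_bisim u w : to_left u w -> world_bisim u w.
Proof.
apply: (bisimulation_bisimilar (N := star companion) (N' := star M)).
exact: bisimulation_comp (projection_bisimulation _ _ _) (inl_bisimulation _ _).
Qed.

Lemma to_right_bisim u w : to_right u w -> world_bisim u w.
Proof.
apply: (bisimulation_bisimilar (N := star companion) (N' := star M')).
exact: bisimulation_comp (projection_bisimulation _ _ _) (inr_bisimulation _ _).
Qed.

End Transfer.

Lemma world_property_finite_depth (C : model_class) (I : Type) (P : world_property I) :
  world_fo_definable C P -> world_bisim_invariant C P ->
  exists (J : finType) (A : J -> I) (l : nat),
    forall (M M' : rel_model I) (w : world M) (w' : world M'),
      in_class C M -> in_class C M' ->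
      world_type A l (w : iworld (star M)) = world_type A l (w' : iworld (star M')) ->
      P M w <-> P M' w'.
Proof.
move=> [phi [x [_ _ phiP]]] Pinv; have [J [A phiA]] := atoms_finite phi.
exists J, A, (2 ^ qrank phi); set l := 2 ^ _ => M M' w w' CM CM' ww'.
pose K := companion A M' l w.
have CK : in_class C K by apply: companion_in_class.
pose u : world K := (ord0, (inl w, inr w')); pose u' : world K := (ord0, (inr w', inl w)).
have pu : @paired I J A _ l u.
  by rewrite /paired /layer /= subn0 world_type_inl world_type_inr.
have uw : world_bisim u w by apply: to_left_bisim; exists (inl w).
have uw' : world_bisim u' w' by apply: to_right_bisim; exists (inr w').
have t0 v : (set0 : set (world K)) v -> layer v = 0 by [].
(* Definability holds under all assignments of the other variables; the empty state has no point in
   any layer, so it avoids every range. *)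
pose b : nat -> state K := fun=> mk_lstate t0.
rewrite -(Pinv _ _ _ _ CK CM uw) -(Pinv _ _ _ _ CK CM' uw').
rewrite (phiP K u CK (fun=> u) b) (phiP K u' CK (fun=> u') (exchange_state 1 \o b)).
have -> : ([eta (fun=> u') with x |-> u'] : nat -> world K) =
    exchange 1 \o ([eta (fun=> u) with x |-> u] : nat -> world K).
  by apply/funext => z /=; case: eqP.
(* All named points lie in layer 0, which leaves the layers 1 to [l], as many as [2 ^ qrank phi].
   Exchanging up to layer 1 turns [u] into [u']. *)
apply: (fo_sat_exchange (lo := 1) (hi := l.+1) phiA) => //.
- by rewrite subSS subn0.
- by rewrite leqnn /= ltnS /l expn_gt0.
- by split=> [z|z v []] /=; case: eqP.
Qed.

Lemma state_property_finite_depth (C : model_class) (I : Type) (P : state_property I) :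
  state_fo_definable C P -> state_bisim_invariant C P ->
  exists (J : finType) (A : J -> I) (l : nat),
    forall (M M' : rel_model I) (s : state M) (s' : state M'),
      in_class C M -> in_class C M' ->
      state_type A (N := star M) l (members s) = state_type A (N := star M') l (members s') ->
      P M s <-> P M' s'.
Proof.
move=> [phi [y [_ _ phiP]]] Pinv; have [J [A phiA]] := atoms_finite phi.
exists J, A, (2 ^ qrank phi); set l := 2 ^ _ => M M' s s' CM CM' ss'.
have [w0] := world_inhabited M.
pose K := companion A M' l w0.
have CK : in_class C K by apply: companion_in_class.
(* All pairs of worlds from [s] and [s'] with equal type are collected in layer 0. Equality of the
   state types makes both projections onto, so this state is bisimilar to [s] and its exchange to
   [s']. *)
pose t := [set u : world K | exists w w', [/\ members s w, members s' w',
  world_type A l (w : iworld (star M)) = world_type A l (w' : iworld (star M')) &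
  u = (ord0, (inl w, inr w'))]].
have tk u : t u -> layer u = 0 by case=> w [w' [_ _ _ ->]].
pose t1 : state K := mk_lstate tk.
have paired_t w w' :
    world_type A l (w : iworld (star M)) = world_type A l (w' : iworld (star M')) ->
    @paired I J A (sum_model (star M) (star M')) l (ord0, (inl w, inr w')).
  by move=> ww'; rewrite /paired /layer /= subn0 world_type_inl world_type_inr.
have ts : state_bisim t1 s.
  split=> [u [w [w' [sw sw' /paired_t ww' uE]]]|w sw].
    by exists w => //; apply: to_left_bisim; exists (inl w) => //; rewrite uE; split.
  have : world_type A l (w : iworld (star M)) \in state_type A (N := star M') l (members s').
    by rewrite -ss'; apply/state_typeP; exists w.
  move=> /state_typeP[w' sw' /esym ww']; exists (ord0, (inl w, inr w')).
    by exists w, w'.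
  by apply: to_left_bisim; exists (inl w) => //; split=> //; apply: paired_t.
pose t2 : state K := exchange_state 1 t1.
have ts' : state_bisim t2 s'.
  split=> [u [_ [w [w' [sw sw' /paired_t ww' ->]]] uE]|w' sw'].
    exists w' => //; apply: to_right_bisim; exists (inr w') => //; rewrite -uE.
    by split=> //; apply/esym.
  have : world_type A l (w' : iworld (star M')) \in state_type A (N := star M) l (members s).
    by rewrite ss'; apply/state_typeP; exists w'.
  move=> /state_typeP[w sw ww']; exists (ord0, (inr w', inl w)).
    by exists (ord0, (inl w, inr w')) => //; exists w, w'.
  apply: to_right_bisim; exists (inr w') => //; split=> //.
  exact/esym/paired_t.
rewrite -(Pinv _ _ _ _ CK CM ts) -(Pinv _ _ _ _ CK CM' ts').
pose a : nat -> world K := fun=> (ord0, (inl w0, inl w0)).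
rewrite (phiP K t1 CK a (fun=> t1)).
rewrite (phiP K t2 CK (exchange 1 \o a) (fun=> t2)).
have -> : ([eta (fun=> t2) with y |-> t2] : nat -> state K) =
    exchange_state 1 \o ([eta (fun=> t1) with y |-> t1] : nat -> state K).
  by apply/funext => z /=; case: eqP.
apply: (fo_sat_exchange (lo := 1) (hi := l.+1) phiA) => //.
- by rewrite subSS subn0.
- by rewrite leqnn /= ltnS /l expn_gt0.
- split=> [//|z v] /=; case: eqP => _ /tk vk; by rewrite /avoids vk.
Qed.

(** * From invariance at finite depth to InqML formulae *)

Lemma world_inqml_definability (C : model_class) (I : Type) (P : world_property I) :
  world_fo_definable C P -> world_bisim_invariant C P -> world_inqml_definable C P.
Proof.
move=> Pfo Pinv; have [J [A [l Pl]]] := world_property_finite_depth Pfo Pinv.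
(* By invariance at depth [l], [P] is a union of type classes over the class of models; [X] collects
   the types realized by its worlds there. *)
pose X : {set ktype J l} := finset (fun tau =>
  `[< exists (M : rel_model I) (w : world M), [/\ in_class C M, P M w &
      world_type A l (w : iworld (star M)) = tau] >]).
have [phi phiP] := declarative_world_type A X.
exists phi => M w CM; rewrite /true_at phiP; split=> [Pw _ ->|/(_ w erefl)].
  by rewrite finset.in_set; apply/asboolP; exists M, w.
rewrite finset.in_set => /asboolP[M' [w' [CM' Pw' /esym ww']]].
exact/(Pl _ _ _ _ CM CM' ww').
Qed.

(** By downward closure, [P] holds at a state iff its types are among those of some state with [P].
    The formula is the inquisitive disjunction, over the finitely many such type sets, of the
    truth-conditional formulae for membership in them. *)
Lemma state_inqml_definability (C : model_class) (I : Type) (P : state_property I) :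
  state_fo_definable C P -> downward_closed C P -> state_bisim_invariant C P ->
  state_nonempty C P -> state_inqml_definable C P.
Proof.
move=> Pfo Pdown Pinv [M0 [s0 [CM0 Ps0]]].
have [J [A [l Pl]]] := state_property_finite_depth Pfo Pinv.
have /choice[phi phiP] := @declarative_world_type I J A l.
pose holds (X : {set ktype J l}) := `[< exists (M : rel_model I) (s : state M),
  [/\ in_class C M, P M s & state_type A (N := star M) l (members s) = X] >].
have subP (M : rel_model I) (s : state M) X : in_class C M -> holds X ->
    state_type A (N := star M) l (members s) \subset X -> P M s.
  move=> CM /asboolP[M' [s' [CM' Ps' s'X]]] sX.
  (* Restricting [s'] to the types that occur in [s] gives a substate with exactly the state type of
     [s]. *)
  pose t := [set w | members s' w /\
    world_type A l (w : iworld (star M')) \in state_type A (N := star M) l (members s)].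
  have [t' t'E] : exists t' : state M', members t' = t.
    by apply: (@rel_powerset _ M' s') => w [].
  apply/(Pl _ _ _ t' CM CM'); last first.
    by apply: Pdown Ps' _ => //; rewrite t'E => w [].
  rewrite t'E; apply/setP => tau; apply/idP/state_typeP => [tau_s|[w [_ ws] <-] //].
  have : tau \in state_type A (N := star M') l (members s').
    by rewrite s'X; apply: fintype.subsetP tau_s.
  by move=> /state_typeP[w sw wtau]; exists w => //; split=> //; rewrite wtau.
exists (inq_any (fun X => if holds X then phi X else Bot)) => M s CM.
rewrite support_any; split=> [Ps|[s_0|[X]]].
- right; exists (state_type A (N := star M) l (members s)).
  have -> : holds (state_type A (N := star M) l (members s)) by apply/asboolP; exists M, s.
  by apply/phiP/sub_state_type.
(* Every disjunction is supported at the empty state; the witness [s0] shows that [P] holds there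
   too. *)
- apply: (subP _ _ (state_type A (N := star M0) l (members s0))) => //.
    by apply/asboolP; exists M0, s0.
  by apply/sub_state_type; rewrite s_0.
- have [hX /phiP/sub_state_type|_ /= s_0] := boolP (holds X); first exact: subP hX.
  apply: (subP _ _ (state_type A (N := star M0) l (members s0))) => //.
    by apply/asboolP; exists M0, s0.
  by apply/sub_state_type; rewrite s_0.
Qed.

(** One world with the full powerset as states is finite and locally full, so it belongs to all four
    classes; its empty state witnesses that a definable property holds somewhere. *)
Definition trivial_model (I : Type) : rel_model I.
Proof.
refine (@RelModel I unit (set unit) (fun _ _ => True) (fun w s => s w) (fun _ => setT)
  (inhabits tt) (inhabits set0) _ _ _ _) => //.
- by move=> s t _; exists t.
- by move=> _; exists set0.
Defined.

Lemma trivial_model_in_class (C : model_class) (I : Type) : in_class C (trivial_model I).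
Proof.
have fin : finite_model (trivial_model I).
  by split; [exact: finite_finset|apply: finite_powerset; exact: finite_finset].
have full : locally_full (trivial_model I) by move=> w t _; exists t.
by case: C.
Qed.

Lemma inqml_state_nonempty (C : model_class) (I : Type) (P : state_property I) :
  state_inqml_definable C P -> state_nonempty C P.
Proof.
move=> [phi phiP]; exists (trivial_model I), set0.
by split; [|apply/phiP; [|apply: support0]]; apply: trivial_model_in_class.
Qed.

Lemma inqml_downward_closed (C : model_class) (I : Type) (P : state_property I) :
  state_inqml_definable C P -> downward_closed C P.
Proof.
move=> [phi phiP] M s t CM /(phiP _ _ CM) Ps ts.
by apply/(phiP _ _ CM); apply: support_down Ps.
Qed.

Theorem theorem1p2 (C : model_class) (I : Type) :
  (forall P : world_property I,
     world_inqml_definable C P <->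
     world_fo_definable C P /\ world_bisim_invariant C P) /\
  (forall P : state_property I,
     state_inqml_definable C P <->
     state_fo_definable C P /\ downward_closed C P /\
     state_bisim_invariant C P /\ state_nonempty C P).
Proof.
split=> P; split.
- by move=> dP; split;
    [exact: inqml_world_fo_definable|exact: inqml_world_bisim_invariant].
- by case; apply: world_inqml_definability.
- move=> dP; split; first exact: inqml_state_fo_definable.
  split; first exact: inqml_downward_closed.
  by split; [exact: inqml_state_bisim_invariant|exact: inqml_state_nonempty].
- by move=> [Pfo [Pdown [Pinv Pne]]]; apply: state_inqml_definability.
Qed.
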